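(* Suppose the SBM has order $k_0$ with parameters $(\pi^0,P^0)$. Then, for a penalty function of the form \[ \mathrm{pen}(k,n) = \sum_{i=1}^{k-1}\frac{i(i+2)+3+\epsilon}{2}\log n, \qquad \epsilon>0, \] we have that \[ \hat{k}_{\mathrm{KT}}(\mathbf{x}_{n\times n}) = k_0 \] eventually almost surely as $n\to\infty$.
   Context: Setting: a non-oriented random network on nodes $\{1,\dots,n\}$ with symmetric adjacency matrix $\mathbf{X}_{n\times n}\in\{0,1\}^{n\times n}$ with zero diagonal. In the Stochastic Block Model (SBM) with $k$ communities, latent labels $Z_1,\dots,Z_n$ are i.i.d. on $[k]=\{1,\dots,k\}$ with distribution $\pi=(\pi_1,\dots,\pi_k)$, and, given the labels $\mathbf{z}_n$, the entries $X_{ij}$ ($i<j$) are independent Bernoulli with parameter $P_{z_i,z_j}$, where $P\in[0,1]^{k\times k}$ is symmetric. Thus \[ \mathbb{P}_{\pi,P}(\mathbf{z}_n,\mathbf{x}_{n\times n})=\prod_{a=1}^k\pi_a^{n_a}\prod_{a,b=1}^k P_{a,b}^{O_{a,b}/2}(1-P_{a,b})^{(n_{a,b}-O_{a,b})/2}, \] with $n_a=\#\{i:z_i=a\}$, $n_{a,b}=n_an_b$ for $a\ne b$, $n_{a,a}=n_a(n_a-1)$, $O_{a,b}=\sum_{i,j}\mathbb{1}\{z_i=a,z_j=b\}x_{ij}$. The parameter space is $\Theta^k=\{(\pi,P):\pi\in(0,1]^k,\sum_a\pi_a=1, P\in[0,1]^{k\times k}\text{ symmetric}\}$. The order $k_0$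 of the SBM is the smallest $k$ for which the law can be represented with some $(\pi^0,P^0)\in\Theta^k$ (so $P^0$ has no two identical columns). Both the dense regime ($P^0$ fixed) and the sparse regime ($P^0=\rho_n S^0$ with $S^0$ fixed, $\rho_n\to0$ and $n\rho_n\to\infty$) are allowed. Only the network $\mathbf{x}_{n\times n}$ is observed. The Krichevsky–Trofimov mixture is $\mathrm{KT}_k(\mathbf{x}_{n\times n})=\int_{\Theta^k}\mathbb{P}_{\pi,P}(\mathbf{x}_{n\times n})\,\nu_k(\pi,P)\,d\pi\,dP$, where $\mathbb{P}_{\pi,P}(\mathbf{x}_{n\times n})=\sum_{\mathbf{z}_n\in[k]^n}\mathbb{P}_{\pi,P}(\mathbf{z}_n,\mathbf{x}_{n\times n})$ and $\nu_k$ is the product of a Dirichlet$(1/2,\dots,1/2)$ prior on $\pi$ and independent Beta$(1/2,1/2)$ priors on the entries $P_{a,b}$, $1\le a\le b\le k$. The KT order estimator is \[ \hat{k}_{\mathrm{KT}}(\mathbf{x}_{n\times n})=\arg\max_k\{\log \mathrm{KT}_k(\mathbf{x}_{n\times n})-\mathrm{pen}(k,n)\}, \] with no known upper bound assumed on $k$. *)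

(* Defs.v *)
From HB Require Import structures.
From mathcomp Require Import all_boot all_order all_algebra.
From mathcomp Require Import all_classical all_reals all_analysis.
Set Implicit Arguments. Unset Strict Implicit. Unset Printing Implicit Defensive.
Import Order.TTheory GRing.Theory Num.Theory.
Import numFieldNormedType.Exports.
Local Open Scope classical_set_scope.
Local Open Scope ring_scope.

Section SBM.
Variable R : realType.

Definition network (n : nat) := 'I_n -> 'I_n -> bool.

Definition valid_network n (x : network n) : bool :=
  [forall i, ~~ x i i] && [forall i, forall j, x i j == x j i].

Definition sbm_joint (k n : nat) (pi : 'I_k -> R) (P : 'I_k -> 'I_k -> R)
    (z : 'I_n -> 'I_k) (x : network n) : R :=
  (\prod_(i < n) pi (z i)) *
  \prod_(i < n) \prod_(j < n | (i < j)%N)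
     (if x i j then P (z i) (z j) else 1 - P (z i) (z j)).

Definition sbm_lik (k n : nat) (pi : 'I_k -> R) (P : 'I_k -> 'I_k -> R)
    (x : network n) : R :=
  \sum_(z : {ffun 'I_n -> 'I_k}) sbm_joint pi P z x.

(* Coordinates of the integration variable for Theta^k:
   inl a (a < k-1) : pi_a ; inr (a,b) (a <= b) : P_{a,b}. *)
Definition par_idx (k : nat) : finType := ('I_k + ('I_k * 'I_k))%type.

Definition par_coords (k : nat) : seq (par_idx k) :=
  map inl (seq.filter (fun a : 'I_k => (a < k.-1)%N) (enum 'I_k)) ++
  map inr (seq.filter (fun ab : 'I_k * 'I_k => (ab.1 <= ab.2)%N)
                  (enum {: 'I_k * 'I_k})).

Definition par_pi k (t : par_idx k -> R) (a : 'I_k) : R :=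
  if (a < k.-1)%N then t (inl a)
  else 1 - \sum_(b < k | (b < k.-1)%N) t (inl b).

Definition par_P k (t : par_idx k -> R) (a b : 'I_k) : R :=
  if (a <= b)%N then t (inr (a, b)) else t (inr (b, a)).

Definition in_simplex k (t : par_idx k -> R) : bool :=
  \sum_(b < k | (b < k.-1)%N) t (inl b) <= 1.

(* unnormalized density of nu_k = Dirichlet(1/2,...,1/2) x prod_{a<=b} Beta(1/2,1/2)
   w.r.t. Lebesgue measure on the free coordinates *)
Definition prior_dens k (t : par_idx k -> R) : R :=
  (if in_simplex t then 1 else 0) *
  (\prod_(a < k) (par_pi t a) `^ (- 2^-1)) *
  \prod_(a < k) \prod_(b < k | (a <= b)%N)
     ((par_P t a b) `^ (- 2^-1) * (1 - par_P t a b) `^ (- 2^-1)).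

Fixpoint iter_int (I : eqType) (s : seq I) (f : (I -> R) -> \bar R)
    (base : I -> R) {struct s} : \bar R :=
  match s with
  | [::] => f base
  | i :: s' => \int[lebesgue_measure]_(u in `[(0:R)%R, (1:R)%R]%classic)
                  iter_int s' f (fun j => if j == i then u else base j)
  end.

Definition int_Theta k (f : (par_idx k -> R) -> R) : \bar R :=
  iter_int (par_coords k) (fun t => (f t)%:E) (fun _ => 0).

Definition KT (k n : nat) (x : network n) : R :=
  fine (int_Theta (fun t : par_idx k -> R => sbm_lik (par_pi t) (par_P t) x * prior_dens t)) /
  fine (int_Theta (@prior_dens k)).

Definition pen (eps : R) (k n : nat) : R :=
  \sum_(1 <= i < k) (((i * (i + 2) + 3)%:R + eps) / 2 * ln n%:R).

Definition KT_crit (eps : R) (n : nat) (x : network n) (k : nat) : R :=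
  ln (KT k x) - pen eps k n.

End SBM.

(* Main.v *)
(* A bad choice of k at size n is an event about the finite random network X n,
   whose law is the mixture over labellings z of the laws given z.  By
   Borel-Cantelli it suffices to bound its probability by a summable sequence.

   Labellings in which some class has fewer than n / K nodes have exponentially
   small total mass.  For the other ("typical") labellings, restricting the prior
   integral to a box of side n^(-1/2) in pi around the class frequencies, and of
   side comparable to the posterior standard deviation in each P_ab, gives
   P0(z, x) <= C n^((k0^2 + 2 k0 - 1) / 2) KT_k0(z, x); the likelihood ratio on the
   box is controlled by a chi-square divergence, and the singularity of the
   Beta(1/2, 1/2) density makes the volume of the box uniform in P_ab.

   Overestimation: KT_k is a probability distribution on networks, so this bound
   and the penalty make the k-th error O(n^(-2 (k - k0))).

   Underestimation: KT_k(x) is at most a sum of exp(O(n)) conditional likelihoods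
   (over labellings and rational edge parameters), so the error is at most
   exp(O(n)) times a Hellinger affinity between two families of independent
   edges.  By pigeonhole a labelling with k < k0 classes merges two true classes
   with distinct columns on a positive fraction of the nodes, so the affinity is
   at most exp(- c rho_n n^2), which wins because n rho_n tends to infinity. *)

(* The exponents balance exactly. A box costs n^(1/2) for each of the k0 - 1 free class
   probabilities and n for each of the k0 (k0 + 1) / 2 edge parameters, since a pair of classes may
   carry of order n^2 edges; in total n^((k0^2 + 2 k0 - 1) / 2). From k to k + 1, with k >= k0, the
   penalty contributes a power of at least (k0 (k0 + 2) + 3) / 2, which is 2 more. This surplus
   makes the errors summable in n and in k - k0, so an unbounded range of k is handled at once.
   Typicality comes from the box in pi: it has to keep a distance of order 1 / K from the faces of
   the simplex for the chi-square divergence to stay bounded. Atypical labellings are never compared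
   with the mixture; only their probability is used. For k < k0 the factor exp(O(n)) collects two
   families of labellings, polynomially many edge parameters, and the polynomial costs of the box
   and of the penalty. Squared differences of square roots of edge probabilities are linear in rho,
   so the dense and the sparse regime are treated together. *)
Require Import Defs.
From HB Require Import structures.
From mathcomp Require Import all_boot all_order all_algebra.
From mathcomp Require Import all_classical all_reals all_analysis.
From mathcomp Require Import measurable_realfun.
From mathcomp Require Import ring lra zify.
Set Implicit Arguments. Unset Strict Implicit. Unset Printing Implicit Defensive.
Import Order.TTheory GRing.Theory Num.Theory.
Import numFieldNormedType.Exports.
Local Open Scope classical_set_scope.
Local Open Scope ring_scope.

(** * Iterated integrals over the unit cube *)

Section IterInt.
Variable (R : realType) (I : finType).
Local Notation mu := (@lebesgue_measure R).
Local Notation U01 := (`[(0:R)%R, (1:R)%R]%classic).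

(** The product Borel structure on [I -> R], generated by the coordinate maps. Tonelli has to be
    applied at every level of [iter_int], which calls for joint measurability in the base point and
    the new coordinate. *)
Definition coord_cylinders : set (set (I -> R)) :=
  [set A | exists i, exists2 B, measurable B & A = (fun t : I -> R => t i) @^-1` B].

Definition coord_space := g_sigma_algebraType coord_cylinders.

Definition upd (i : I) (b : I -> R) (u : R) : I -> R :=
  fun j => if j == i then u else b j.

Lemma measurable_coord (i : I) :
  measurable_fun [set: coord_space] (fun t : coord_space => t i).
Proof.
move=> _ B mB; rewrite setTI; apply: sub_sigma_algebra.
by exists i, B.
Qed.

Lemma measurable_upd (i : I) :
  measurable_fun [set: (coord_space * R)%type]
    (fun p => upd i p.1 p.2 : coord_space).
Proof.
apply: (@measurability _ _ (coord_space * R)%type coord_space [set: _] _ coord_cylinders) => //.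
move=> _ [_ [j [B mB ->]]] <-.
rewrite setTI.
case: (eqVneq j i) => [->|ji].
- rewrite (_ : _ @^-1` _ = snd @^-1` B).
    by rewrite -[X in measurable X]setTI; exact: measurable_snd.
  by apply/seteqP; split=> -[t u]; rewrite /preimage/= /upd eqxx.
- rewrite (_ : _ @^-1` _ = (fun p : coord_space * R => p.1 j) @^-1` B); last first.
    by apply/seteqP; split=> -[t u]; rewrite /preimage/= /upd (negbTE ji).
  rewrite -[X in measurable X]setTI.
  have h : measurable_fun [set: (coord_space * R)%type]
      ((fun t : coord_space => t j) \o fst).
    by apply: measurableT_comp; [exact: measurable_coord|exact: measurable_fst].
  exact: h.
Qed.

Lemma measurable_updr (i : I) (b : I -> R) :
  measurable_fun [set: R] (fun u => upd i b u : coord_space).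
Proof.
rewrite (_ : (fun u => _) = (fun p : coord_space * R => upd i p.1 p.2 : coord_space) \o (fun u => (b : coord_space, u)))//.
by apply: measurableT_comp; [exact: measurable_upd|exact: measurable_pair1].
Qed.

Definition emeas (f : (I -> R) -> \bar R) :=
  @measurable_fun _ _ coord_space (\bar R) setT f.

Local Open Scope ereal_scope.

Lemma iter_int_ge0 (s : seq I) (f : (I -> R) -> \bar R) b :
  (forall t, 0 <= f t) -> 0 <= iter_int s f b.
Proof.
move=> f0; elim: s b => [|i s IH] b //=.
by apply: integral_ge0 => u _; exact: IH.
Qed.

Lemma measurable_iter_int (s : seq I) (f : (I -> R) -> \bar R) :
  (forall t, 0 <= f t) -> emeas f ->
  emeas (iter_int s f).
Proof.
move=> f0 mf; elim: s => [|i s IH] //=; rewrite /emeas.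
(* The indicator turns the integral over the unit interval into a partial integral over the line,
   whose measurability is part of Tonelli's theorem. *)
pose g := (fun p : coord_space * R =>
  ((\1_U01 p.2)%:E * iter_int s f (upd i p.1 p.2))).
rewrite (_ : (fun base : coord_space => _) = fubini_F mu g); last first.
  apply/funext => b; rewrite /fubini_F /g /= [LHS]integral_mkcond.
  apply: eq_integral => u _; rewrite patchE indicE.
  by case: ifP => _; rewrite ?mul1e ?mul0e.
apply: measurable_fun_fubini_tonelli_F => //.
- have h1 : measurable_fun [set: (coord_space * R)%type]
      (fun p : coord_space * R => (\1_U01 p.2 : R)%:E).
    have h : measurable_fun [set: (coord_space * R)%type] ((\1_U01 : R -> R) \o snd).
      have h0 : measurable_fun [set: R] (\1_U01 : R -> R) by exact: measurable_indic.
      exact: (measurableT_comp h0 (@measurable_snd _ _ coord_space R)).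
    by apply/measurable_EFinP.
  have h2 : measurable_fun [set: (coord_space * R)%type]
      (fun p : coord_space * R => iter_int s f (upd i p.1 p.2)).
    exact: (@measurableT_comp _ _ _ _ coord_space _ _ _ _ IH (measurable_upd i)).
  exact: (emeasurable_funM h1 h2).
- by move=> p; rewrite /g mule_ge0// ?lee_fin ?indicE// iter_int_ge0.
Qed.

Lemma measurable_iter_int_upd (s : seq I) (f : (I -> R) -> \bar R) i b (D : set R) :
  (forall t, 0 <= f t) -> emeas f ->
  measurable_fun D (fun u => iter_int s f (upd i b u)).
Proof.
move=> f0 mf; apply: measurable_funTS.
exact: (@measurableT_comp _ _ _ _ coord_space _ _ _ _
  (measurable_iter_int s f0 mf) (measurable_updr i b)).
Qed.

Lemma iter_intD (s : seq I) (f g : (I -> R) -> \bar R) b :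
  (forall t, 0 <= f t) -> emeas f ->
  (forall t, 0 <= g t) -> emeas g ->
  iter_int s (fun t => f t + g t) b = iter_int s f b + iter_int s g b.
Proof.
move=> f0 mf g0 mg; elim: s b => [|i s IH] b //=.
under eq_integral do rewrite IH.
rewrite ge0_integralD//.
- by move=> u _; exact: iter_int_ge0.
- exact: measurable_iter_int_upd.
- by move=> u _; exact: iter_int_ge0.
- exact: measurable_iter_int_upd.
Qed.

Lemma iter_int0 (s : seq I) b : iter_int s (fun _ => 0 : \bar R) b = 0.
Proof.
by elim: s b => [|i s IH] b //=; rewrite integral0_eq// => u _; exact: IH.
Qed.

Lemma emeas_sum (J : Type) (r : seq J) (P : pred J) (f : J -> (I -> R) -> \bar R) :
  (forall j, emeas (f j)) -> emeas (fun t => \sum_(j <- r | P j) f j t).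
Proof.
move=> mf; elim: r => [|j r IH]; rewrite /emeas.
  rewrite (_ : (fun t => _) = cst 0); first exact: measurable_cst.
  by apply/funext => t; rewrite big_nil.
have [Pj|Pj] := boolP (P j).
  rewrite (_ : (fun t => _) = (f j \+ (fun t => \sum_(i <- r | P i) f i t))).
    exact: (@emeasurable_funD _ coord_space _ _ _ _ (mf j) IH).
  by apply/funext => t; rewrite big_cons Pj.
rewrite (_ : (fun t => _) = (fun t => \sum_(i <- r | P i) f i t))//.
by apply/funext => t; rewrite big_cons (negbTE Pj).
Qed.

Lemma iter_int_sum (J : Type) (r : seq J) (P : pred J) (s : seq I)
    (f : J -> (I -> R) -> \bar R) b :
  (forall j t, 0 <= f j t) ->
  (forall j, emeas (f j)) ->
  iter_int s (fun t => \sum_(j <- r | P j) f j t) b =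
  \sum_(j <- r | P j) iter_int s (f j) b.
Proof.
move=> f0 mf; elim: r => [|j r IH].
  rewrite big_nil (_ : (fun t => _) = fun=> 0) ?iter_int0//.
  by apply/funext => t; rewrite big_nil.
rewrite big_cons -IH; case: ifPn => Pj.
  rewrite -iter_intD//.
  - by congr iter_int; apply/funext => t; rewrite big_cons Pj.
  - by move=> t; exact: sume_ge0.
  - exact: emeas_sum.
by congr iter_int; apply/funext => t; rewrite big_cons (negbTE Pj).
Qed.

Lemma iter_intZ (s : seq I) (f : (I -> R) -> \bar R) (c : R) b : (0 <= c)%R ->
  (forall t, 0 <= f t) -> emeas f ->
  iter_int s (fun t => c%:E * f t) b = c%:E * iter_int s f b.
Proof.
move=> c0 f0 mf; elim: s b => [|i s IH] b //=.
under eq_integral do rewrite IH.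
rewrite ge0_integralZl//.
- exact: measurable_iter_int_upd.
- by move=> u _; exact: iter_int_ge0.
Qed.

(** Iterated integration only overwrites coordinates by values in the unit interval. Starting from a
    base point in the cube, integrands therefore have to be compared on the cube only. *)
Definition in_cube (t : I -> R) := forall i, (0 <= t i <= 1)%R.

Lemma in_cube_upd i b u : in_cube b -> u \in U01 -> in_cube (upd i b u).
Proof.
move=> cb uU j; rewrite /upd; case: ifP => // _.
by move: uU; rewrite inE/= in_itv/=.
Qed.

Lemma eq_iter_int (s : seq I) (f g : (I -> R) -> \bar R) b :
  in_cube b -> (forall t, in_cube t -> f t = g t) ->
  iter_int s f b = iter_int s g b.
Proof.
move=> + fg; elim: s b => [|i s IH] b cb /=; first exact: fg.
by apply: eq_integral => u uU; apply: IH; exact: in_cube_upd.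
Qed.

Lemma le_iter_int (s : seq I) (f g : (I -> R) -> \bar R) b :
  in_cube b -> (forall t, in_cube t -> f t <= g t) ->
  (forall t, 0 <= f t) -> emeas f ->
  (forall t, 0 <= g t) -> emeas g ->
  iter_int s f b <= iter_int s g b.
Proof.
move=> + fg f0 mf g0 mg; elim: s b => [|i s IH] b cb /=; first exact: fg.
apply: ge0_le_integral => //.
- by move=> u _; exact: iter_int_ge0.
- exact: measurable_iter_int_upd.
- exact: measurable_iter_int_upd.
- by move=> u uU; apply: IH; apply: in_cube_upd => //; rewrite inE.
Qed.

Lemma iter_int_cat (s1 s2 : seq I) (f : (I -> R) -> \bar R) b :
  iter_int (s1 ++ s2) f b = iter_int s1 (iter_int s2 f) b.
Proof. by elim: s1 b => [|i s IH] b //=; apply: eq_integral => u _; exact: IH. Qed.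

Lemma iter_int_box (s : seq I) (f : (I -> R) -> \bar R) b (l r : I -> R) (V : R) :
  (0 <= V)%R -> uniq s ->
  (forall i, i \in s -> [&& 0 <= l i, l i <= r i & r i <= 1]%R) ->
  (forall t, (forall i, i \in s -> l i <= t i <= r i)%R ->
     (forall i, i \notin s -> t i = b i) -> V%:E <= f t) ->
  (forall t, 0 <= f t) -> emeas f ->
  (V * \prod_(i <- s) (r i - l i))%:E <= iter_int s f b.
Proof.
move=> V0 us lr fV f0 mf; elim: s b us lr fV => [|i s IH] b /=.
  by move=> _ _ fV; rewrite big_nil mulr1; exact: fV.
move=> /andP[is_ us] lr fV.
have /and3P[l0 lri r1] := lr i (mem_head _ _).
have IHu u : (l i <= u <= r i)%R ->
    (V * \prod_(j <- s) (r j - l j))%:E <= iter_int s f (upd i b u).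
  move=> hu; apply: IH => //.
    by move=> j js; apply: lr; rewrite inE js orbT.
  move=> t tbox tb; apply: fV.
    move=> j; rewrite inE => /orP[/eqP ->|]; last exact: tbox.
    by rewrite tb// /upd eqxx.
  move=> j; rewrite inE negb_or => /andP[ji js].
  by rewrite tb// /upd (negbTE ji).
apply: (@le_trans _ _ (\int[mu]_(u in `[l i, r i]) iter_int s f (upd i b u))); last first.
  apply: ge0_subset_integral => //.
  - exact: measurable_iter_int_upd.
  - by move=> u _; exact: iter_int_ge0.
  - by apply: subset_itv; rewrite !bnd_simp.
apply: (@le_trans _ _ (\int[mu]_(u in `[l i, r i])
    (V * \prod_(j <- s) (r j - l j))%:E)).
  rewrite integral_cst//= lebesgue_measure_itv/= lte_fin.
  rewrite big_cons; case: ltP => lr'.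
    by rewrite -EFinD -EFinM lee_fin mulrCA mulrC.
  by rewrite mule0 lee_fin (_ : r i = l i) ?subrr ?mul0r ?mulr0//; apply/le_anti; rewrite lri lr'.
apply: ge0_le_integral => //.
- move=> u _; rewrite lee_fin mulr_ge0//.
  rewrite big_seq; apply: prodr_ge0 => j js.
  have /and3P[_ lrj _] : [&& 0 <= l j, l j <= r j & r j <= 1]%R.
    by apply: lr; rewrite inE js orbT.
  by rewrite subr_ge0.
- exact: measurable_iter_int_upd.
Qed.

End IterInt.

(** * Inverse square root singularities *)

Section Singular.
Variable (R : realType).
Local Notation mu := (@lebesgue_measure R).
Local Notation U01 := (`[(0:R)%R, (1:R)%R]%classic).

(** The value 0 on nonpositive arguments lets this one function, applied to the last class
    probability, carry both its density factor and the indicator of the simplex. *)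
Definition isqrt_pos (x : R) : R := if 0 < x then x `^ (- 2^-1) else 0.

Lemma isqrt_pos_ge0 x : 0 <= isqrt_pos x.
Proof. by rewrite /isqrt_pos; case: ifP => // _; exact: powR_ge0. Qed.

Lemma isqrt_pos_powR x : 0 <= x -> isqrt_pos x = x `^ (- 2^-1).
Proof.
rewrite /isqrt_pos le_eqVlt => /predU1P[<-|->]//.
by rewrite ltxx powR0// oppr_eq0 invr_eq0 pnatr_eq0.
Qed.

Lemma isqrt_posE x : 0 < x -> isqrt_pos x = (Num.sqrt x)^-1.
Proof. by move=> x0; rewrite /isqrt_pos x0 powRN powR12_sqrt// ltW. Qed.

Lemma isqrt_pos_ge1 x : 0 < x <= 1 -> 1 <= isqrt_pos x.
Proof.
move=> /andP[x0 x1]; rewrite isqrt_posE// invr_ge1; last 2 first.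
- by rewrite unitfE gt_eqF// sqrtr_gt0.
- by rewrite sqrtr_gt0.
by rewrite -[leRHS]sqrtr1 ler_wsqrtr.
Qed.

Lemma measurable_isqrt_pos : measurable_fun [set: R] isqrt_pos.
Proof.
have h1 := @measurable_powR R (- 2^-1).
have h2 : measurable_fun [set: R] (fun x : R => 0 < x) by exact: measurable_fun_ltr.
exact: (measurable_fun_ifT h2 h1 (measurable_cst _)).
Qed.

Lemma isqrt_pos_dyadic (x : R) (j : nat) :
  (4^-1) ^+ j.+1 < x -> isqrt_pos x <= 2 ^+ j.+1.
Proof.
move=> jx; have x0 : 0 < x by apply: lt_trans jx; rewrite exprn_gt0// invr_gt0.
rewrite isqrt_posE// -[leRHS]invrK lef_pV2 ?posrE ?sqrtr_gt0 ?invr_gt0 ?exprn_gt0//.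
rewrite -[leLHS]ger0_norm ?invr_ge0 ?exprn_ge0// -sqrtr_sqr ler_wsqrtr//.
apply: ltW; apply: le_lt_trans jx.
by rewrite exprVn expr2 -invfM -exprMn (_ : 2 * 2 = 4 :> R)//; ring.
Qed.

Lemma exists_dyadic (x : R) : 0 < x -> x <= 1 ->
  exists j, (4^-1) ^+ j.+1 < x /\ x <= (4^-1) ^+ j.
Proof.
move=> x0 x1.
have ex : exists j, (4^-1 : R) ^+ j.+1 < x.
  exists (Num.bound x^-1).
  rewrite exprVn -[ltRHS]invrK ltf_pV2 ?posrE ?invr_gt0 ?exprn_gt0//.
  have /lt_le_trans -> // : x^-1 < (Num.bound x^-1)%:R.
    by apply: le_lt_trans (archi_boundP _); rewrite ?invr_ge0 ?(ltW x0)// ler_norm.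
  rewrite -natrX ler_nat; apply: (@leq_trans (4 ^ Num.bound x^-1)).
    exact/ltnW/ltn_expl.
  by rewrite leq_exp2l.
case: (ex_minnP ex) => j hj jmin; exists j; split => //.
case: j hj jmin => [|j] hj jmin; first by rewrite expr0.
rewrite leNgt; apply/negP => /jmin; by rewrite ltnn.
Qed.

Local Open Scope ereal_scope.

(* Layer-cake over the dyadic shells (4^-(j+1), 4^-j] of the values of phi. *)
Lemma integral_isqrt_pos_le (phi : R -> R) :
  measurable_fun [set: R] phi ->
  (forall r : R, (0 <= r)%R -> mu [set u | (0 < phi u <= r)%R] <= r%:E) ->
  (forall u, (0 <= u <= 1)%R -> (phi u <= 1)%R) ->
  \int[mu]_(u in U01) (isqrt_pos (phi u))%:E <= 4%:E.
Proof.
move=> mphi hphi phi1.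
(* Whole sublevel sets replace the shells: the single term whose shell contains [phi u] already
   dominates, and a sublevel set has measure at most 4^-j. The total is the sum of 2^(j+1) 4^-j,
   which is 4. *)
pose A j := [set u | (0 < phi u <= (4^-1) ^+ j)%R].
have mA j : measurable (A j).
  rewrite (_ : A j = phi @^-1` `]0%R, ((4^-1) ^+ j)%R]).
    by rewrite -[X in measurable X]setTI; exact: mphi.
  by apply/seteqP; split => u; rewrite /= in_itv.
pose F j u : \bar R := (2 ^+ j.+1)%:E * (\1_(A j) u)%:E.
have F0 j u : 0 <= F j u by rewrite /F -EFinM lee_fin mulr_ge0// exprn_ge0.
have mI j : measurable_fun U01 (fun u : R => (\1_(A j) u : R)%:E).
  apply/measurable_EFinP.
  by apply: measurable_funTS; exact: measurable_indic.
have mF j : measurable_fun U01 (F j) by apply: measurable_funeM; exact: mI.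
apply: (@le_trans _ _ (\int[mu]_(u in U01) \sum_(j <oo) F j u)).
  apply: ge0_le_integral => //.
  - by move=> u _; rewrite lee_fin isqrt_pos_ge0.
  - apply: measurable_funTS; apply/measurable_EFinP.
    by apply: measurableT_comp => //; exact: measurable_isqrt_pos.
  - by apply: ge0_emeasurable_sum => // j _; exact: mF.
  - move=> u; rewrite /= in_itv/= => /phi1 pu1.
    have [pu0|pu0] := ltP 0%R (phi u); last first.
      rewrite /isqrt_pos ltNge pu0/=.
      by apply: nneseries_ge0 => j _ _; exact: F0.
    have [j [j1 j2]] := exists_dyadic pu0 pu1.
    apply: le_trans (nneseries_lim_ge j.+1 _); last by move=> ? _ _; exact: F0.
    rewrite big_mkord big_ord_recr/=.
    apply: (@le_trans _ _ (F j u)).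
      rewrite /F indicE mem_set ?mulr1; last by rewrite /A /= pu0.
      by rewrite mule1 lee_fin; exact: isqrt_pos_dyadic.
    by rewrite leeDr// sume_ge0.
rewrite integral_nneseries//.
apply: (@le_trans _ _ (\sum_(j <oo) (2 * (2^-1) ^+ j)%:E)).
  apply: lee_nneseries => [j *|j *]; first by apply: integral_ge0.
  rewrite /F ge0_integralZl//; last exact: mI.
  rewrite integral_indic//; last exact: mA.
  apply: (@le_trans _ _ ((2 ^+ j.+1)%:E * ((4^-1) ^+ j)%:E)).
    apply: lee_wpmul2l; first by rewrite lee_fin exprn_ge0.
    apply: le_trans (hphi ((4^-1) ^+ j)%R _); last by rewrite exprn_ge0// invr_ge0.
    apply: le_measure; rewrite ?inE.
    - by apply: measurableI => //; exact: mA.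
    - exact: mA.
    - by move=> u [].
  rewrite -EFinM lee_fin exprS -mulrA ler_pM2l// -exprMn.
  by rewrite (_ : 2 * 4^-1 = 2^-1 :> R)%R//; lra.
have h0 (j : nat) : 0 <= (2 * (2^-1) ^+ j : R)%:E.
  by rewrite lee_fin mulr_ge0// exprn_ge0// invr_ge0.
have hn (n : nat) : \sum_(0 <= j < n) (2 * (2^-1) ^+ j : R)%:E <= 4%:E.
  rewrite sumEFin lee_fin.
  rewrite (_ : \sum_(0 <= i < n) _ = 4 - 4 * (2^-1) ^+ n)%R.
    by rewrite gerBl mulr_ge0// exprn_ge0// invr_ge0.
  elim: n => [|n IH]; first by rewrite big_nil expr0 mulr1 subrr.
  by rewrite big_nat_recr//= IH exprS; field.
have cv : cvgn (fun n => \sum_(0 <= j < n) (2 * (2^-1) ^+ j : R)%:E).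
  by apply: is_cvg_nneseries => j _ _; exact: h0.
exact: (lime_le cv (nearW _ hn)).
Qed.

Lemma integral_isqrt : \int[mu]_(u in U01) (isqrt_pos u)%:E <= 4%:E.
Proof.
apply: integral_isqrt_pos_le => //.
- move=> r r0; rewrite (_ : [set u | _] = `]0%R, r]%classic); last first.
    by apply/seteqP; split => u; rewrite /= in_itv.
  by rewrite lebesgue_measure_itv/= lte_fin; case: ifP => // _; rewrite sube0.
- by move=> u /andP[].
Qed.

Lemma integral_isqrt_sub (s : R) : (s <= 1)%R ->
  \int[mu]_(u in U01) (isqrt_pos (s - u))%:E <= 4%:E.
Proof.
move=> s1; apply: integral_isqrt_pos_le => //.
- exact: measurable_funB.
- move=> r r0; rewrite (_ : [set u | _] = `[(s - r)%R, s[%classic); last first.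
    by apply/seteqP; split => u; rewrite /= in_itv/= => /andP[a b];
      apply/andP; split; lra.
  rewrite lebesgue_measure_itv/= lte_fin; case: ifP => //= _.
  by rewrite -EFinB lee_fin; lra.
- by move=> u /andP[u0 u1]; lra.
Qed.

Lemma measurable_isqrt_sub (s : R) (D : set R) :
  measurable_fun D (fun u : R => (isqrt_pos (s - u))%:E).
Proof.
apply: measurable_funTS; apply/measurable_EFinP.
apply: (measurableT_comp measurable_isqrt_pos).
exact: measurable_funB.
Qed.

Lemma measurable_isqrt (D : set R) :
  measurable_fun D (fun u : R => (isqrt_pos u)%:E).
Proof.
by apply: measurable_funTS; apply/measurable_EFinP; exact: measurable_isqrt_pos.
Qed.

Lemma measurable_isqrt_conv (s : R) (D : set R) :
  measurable_fun D (fun u : R => (isqrt_pos u * isqrt_pos (s - u))%:E).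
Proof.
rewrite (_ : (fun u => _) = (fun u => (isqrt_pos u)%:E * (isqrt_pos (s - u))%:E))//.
by apply: emeasurable_funM; [exact: measurable_isqrt|exact: measurable_isqrt_sub].
Qed.

(** One of u and s - u is at least s / 2, so its inverse square root is at most twice that of s,
    while the other factor has integral at most 4; this gives 2 (4 + 4). The exact convolution is
    constant for s > 0; the weaker form with [isqrt_pos s] reproduces itself under iteration. *)
Lemma isqrt_convolution (s : R) : (s <= 1)%R ->
  \int[mu]_(u in U01) (isqrt_pos u * isqrt_pos (s - u))%:E
    <= (16 * isqrt_pos s)%:E.
Proof.
move=> s1; have [s0|s0] := ltP 0%R s; last first.
  rewrite integral0_eq ?lee_fin ?mulr_ge0 ?isqrt_pos_ge0// => u.
  rewrite /= in_itv/= => /andP[u0 _].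
  by rewrite [isqrt_pos (_ - _)]/isqrt_pos ltNge (_ : s - u <= 0)%R ?mulr0//=; lra.
have half (x : R) : (s <= 2 * x)%R -> (isqrt_pos x <= 2 * isqrt_pos s)%R.
  move=> sx; have x0 : (0 < x)%R by lra.
  rewrite !isqrt_posE// -[leRHS]invrK lef_pV2 ?posrE ?sqrtr_gt0 ?invr_gt0 ?mulr_gt0 ?invr_gt0 ?sqrtr_gt0//.
  rewrite invfM invrK -[leLHS]ger0_norm ?mulr_ge0 ?invr_ge0 ?sqrtr_ge0// -sqrtr_sqr.
  by rewrite ler_wsqrtr// exprMn sqr_sqrtr; lra.
apply: (@le_trans _ _ (\int[mu]_(u in U01)
    ((2 * isqrt_pos s)%:E * ((isqrt_pos u)%:E + (isqrt_pos (s - u))%:E)))).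
  apply: ge0_le_integral => //.
  - by move=> u _; rewrite lee_fin mulr_ge0// isqrt_pos_ge0.
  - exact: measurable_isqrt_conv.
  - apply: measurable_funeM.
    by apply: emeasurable_funD; [exact: measurable_isqrt|exact: measurable_isqrt_sub].
  - move=> u; rewrite /= in_itv/= => /andP[u0 u1].
    rewrite -EFinD -EFinM lee_fin.
    have p1 := isqrt_pos_ge0 u; have p2 := isqrt_pos_ge0 (s - u).
    have ps := isqrt_pos_ge0 s.
    have [us|us] := leP s (2 * u)%R.
      have h := half _ us.
      apply: (le_trans (ler_wpM2r p2 h)).
      by rewrite ler_wpM2l ?mulr_ge0// lerDr.
    have h : (isqrt_pos (s - u) <= 2 * isqrt_pos s)%R by apply: half; lra.
    rewrite mulrC; apply: (le_trans (ler_wpM2r p1 h)).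
    by rewrite ler_wpM2l ?mulr_ge0// lerDl.
rewrite ge0_integralZl//; last 3 first.
- by apply: emeasurable_funD; [exact: measurable_isqrt|exact: measurable_isqrt_sub].
- by move=> u _; rewrite -EFinD lee_fin addr_ge0// isqrt_pos_ge0.
- by rewrite lee_fin mulr_ge0// isqrt_pos_ge0.
rewrite (_ : (16 * isqrt_pos s)%:E = (2 * isqrt_pos s)%:E * (4 + 4)%:E); last first.
  by rewrite -EFinM; congr EFin; ring.
apply: lee_wpmul2l; first by rewrite lee_fin mulr_ge0// isqrt_pos_ge0.
rewrite ge0_integralD//.
- by rewrite EFinD leeD// ?integral_isqrt ?integral_isqrt_sub.
- by move=> u _; rewrite lee_fin isqrt_pos_ge0.
- exact: measurable_isqrt.
- by move=> u _; rewrite lee_fin isqrt_pos_ge0.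
- exact: measurable_isqrt_sub.
Qed.

Variable I : finType.

(** Fixing one coordinate at u leaves the same problem with s - u in place of s, and integrating
    over u is then a convolution. Only finiteness of the Dirichlet mass is at stake, so the constant
    is crude. *)
Lemma iter_int_dirichlet_le (l : seq I) (f : (I -> R) -> \bar R) b (c s : R) :
  (0 <= c)%R -> (s <= 1)%R -> uniq l -> in_cube b ->
  (forall t, in_cube t -> (forall i, i \notin l -> t i = b i) ->
     f t <= (c * (\prod_(i <- l) isqrt_pos (t i))
               * isqrt_pos (s - \sum_(i <- l) t i))%:E) ->
  (forall t, 0 <= f t) -> emeas f ->
  iter_int l f b <= (16 ^+ size l * c * isqrt_pos s)%:E.
Proof.
move=> + + + + + f0 mf; elim: l b c s => [|i l IH] b c s c0 s1 /=.
  move=> _ cb /(_ _ cb (fun i _ => erefl)).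
  by rewrite !big_nil mulr1 subr0 expr0 mul1r.
move=> /andP[il ul] cb hf.
apply: (@le_trans _ _ (\int[mu]_(u in U01)
    ((16 ^+ size l * c)%:E * (isqrt_pos u * isqrt_pos (s - u))%:E))).
  apply: ge0_le_integral => //.
  - by move=> u _; exact: iter_int_ge0.
  - exact: measurable_iter_int_upd.
  - by apply: measurable_funeM; exact: measurable_isqrt_conv.
  - move=> u uU.
    have /andP[u0 u1] : (0 <= u <= 1)%R by move: uU; rewrite /= in_itv.
    have cub : in_cube (upd i b u) by apply: in_cube_upd => //; rewrite inE.
    rewrite -EFinM mulrA -(mulrA _ c).
    apply: IH => //.
    + by rewrite mulr_ge0// isqrt_pos_ge0.
    + lra.
    + move=> t ct tb.
      have tiu : t i = u by rewrite tb// /upd eqxx.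
      apply: le_trans (hf t ct _) _.
        move=> j; rewrite inE negb_or => /andP[ji jl].
        by rewrite tb// /upd (negbTE ji).
      by rewrite !big_cons tiu mulrA opprD addrA.
rewrite ge0_integralZl//; last 3 first.
- exact: measurable_isqrt_conv.
- by move=> u _; rewrite lee_fin mulr_ge0// isqrt_pos_ge0.
- by rewrite lee_fin mulr_ge0// exprn_ge0.
rewrite (_ : (16 ^+ _ * c * _)%:E = (16 ^+ size l * c)%:E * (16 * isqrt_pos s)%:E).
  apply: lee_wpmul2l; first by rewrite lee_fin mulr_ge0// exprn_ge0.
  exact: isqrt_convolution.
by rewrite -EFinM exprS; congr EFin; ring.
Qed.

Lemma iter_int_beta_le (l : seq I) (f : (I -> R) -> \bar R) b (c : R) :
  (0 <= c)%R -> uniq l -> in_cube b ->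
  (forall t, in_cube t -> (forall i, i \notin l -> t i = b i) ->
     f t <= (c * (\prod_(i <- l) (isqrt_pos (t i) * isqrt_pos (1 - t i))))%:E) ->
  (forall t, 0 <= f t) -> emeas f ->
  iter_int l f b <= (16 ^+ size l * c)%:E.
Proof.
move=> + + + + f0 mf; elim: l b c => [|i l IH] b c c0 /=.
  move=> _ cb /(_ _ cb (fun i _ => erefl)).
  by rewrite !big_nil mulr1 expr0 mul1r.
move=> /andP[il ul] cb hf.
apply: (@le_trans _ _ (\int[mu]_(u in U01)
    ((16 ^+ size l * c)%:E * (isqrt_pos u * isqrt_pos (1 - u))%:E))).
  apply: ge0_le_integral => //.
  - by move=> u _; exact: iter_int_ge0.
  - exact: measurable_iter_int_upd.
  - by apply: measurable_funeM; exact: measurable_isqrt_conv.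
  - move=> u uU.
    have /andP[u0 u1] : (0 <= u <= 1)%R by move: uU; rewrite /= in_itv.
    have cub : in_cube (upd i b u) by apply: in_cube_upd => //; rewrite inE.
    rewrite -EFinM -mulrA.
    apply: IH => //.
    + by rewrite !mulr_ge0// isqrt_pos_ge0.
    + move=> t ct tb.
      have tiu : t i = u by rewrite tb// /upd eqxx.
      apply: le_trans (hf t ct _) _.
        move=> j; rewrite inE negb_or => /andP[ji jl].
        by rewrite tb// /upd (negbTE ji).
      by rewrite !big_cons tiu mulrA.
rewrite ge0_integralZl//; last 3 first.
- exact: measurable_isqrt_conv.
- by move=> u _; rewrite lee_fin mulr_ge0// isqrt_pos_ge0.
- by rewrite lee_fin mulr_ge0// exprn_ge0.
rewrite [leRHS](_ : _ = (16 ^+ size l * c)%:E * (16 * isqrt_pos 1)%:E).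
  apply: lee_wpmul2l; first by rewrite lee_fin mulr_ge0// exprn_ge0.
  exact: isqrt_convolution.
by rewrite isqrt_posE// sqrtr1 invr1 -EFinM exprS; congr EFin; ring.
Qed.

End Singular.

(** * Integration against the prior *)

Section RealMeas.
Variable (R : realType) (I : finType).

Definition rmeas (f : (I -> R) -> R) :=
  @measurable_fun _ _ (coord_space R I) R setT f.

Lemma rmeas_emeas f : rmeas f -> emeas (fun t => (f t)%:E).
Proof. by move=> mf; apply/measurable_EFinP. Qed.

Lemma rmeas_coord i : rmeas (fun t => t i).
Proof. exact: measurable_coord. Qed.

Lemma rmeas_cst c : rmeas (fun=> c).
Proof. exact: measurable_cst. Qed.

Lemma rmeasD f g : rmeas f -> rmeas g -> rmeas (fun t => f t + g t).
Proof. by move=> mf mg; exact: (measurable_funD mf mg). Qed.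

Lemma rmeasB f g : rmeas f -> rmeas g -> rmeas (fun t => f t - g t).
Proof. by move=> mf mg; exact: (measurable_funB mf mg). Qed.

Lemma rmeasM f g : rmeas f -> rmeas g -> rmeas (fun t => f t * g t).
Proof. by move=> mf mg; exact: (measurable_funM mf mg). Qed.

Lemma rmeas_norm f : rmeas f -> rmeas (fun t => `|f t|).
Proof. by move=> mf; exact: (measurableT_comp (@normr_measurable R setT) mf). Qed.

Lemma rmeas_powR f p : rmeas f -> rmeas (fun t => f t `^ p).
Proof. by move=> mf; exact: (measurableT_comp (@measurable_powR R p) mf). Qed.

Lemma rmeas_sum (J : Type) (r : seq J) (P : pred J) (f : J -> (I -> R) -> R) :
  (forall j, rmeas (f j)) -> rmeas (fun t => \sum_(j <- r | P j) f j t).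
Proof.
move=> mf; elim: r => [|j r IH].
  rewrite (_ : (fun t => _) = fun=> 0); first exact: rmeas_cst.
  by apply/funext => t; rewrite big_nil.
rewrite (_ : (fun t => _) =
  (fun t => (if P j then f j t else 0) + \sum_(i <- r | P i) f i t)).
  by apply: rmeasD => //; case: (P j) => //; exact: rmeas_cst.
by apply/funext => t; rewrite big_cons; case: ifP; rewrite ?add0r.
Qed.

Lemma rmeas_prod (J : Type) (r : seq J) (P : pred J) (f : J -> (I -> R) -> R) :
  (forall j, rmeas (f j)) -> rmeas (fun t => \prod_(j <- r | P j) f j t).
Proof.
move=> mf; elim: r => [|j r IH].
  rewrite (_ : (fun t => _) = fun=> 1); first exact: rmeas_cst.
  by apply/funext => t; rewrite big_nil.
rewrite (_ : (fun t => _) =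
  (fun t => (if P j then f j t else 1) * \prod_(i <- r | P i) f i t)).
  by apply: rmeasM => //; case: (P j) => //; exact: rmeas_cst.
by apply/funext => t; rewrite big_cons; case: ifP; rewrite ?mul1r.
Qed.

Lemma rmeas_if_le f (c a b : R) : rmeas f -> rmeas (fun t => if f t <= c then a else b).
Proof.
move=> mf; apply: measurable_fun_ifT => //.
by apply: measurable_fun_ler.
Qed.

End RealMeas.

(** * The unnormalized Dirichlet-Beta prior and its integrable functions *)

Section Prior.
Variable (R : realType) (k : nat).
Hypothesis hk : (0 < k)%N.
Implicit Types (t : par_idx k -> R).

Definition cell (a b : 'I_k) : 'I_k * 'I_k := if (a <= b)%N then (a, b) else (b, a).

Lemma par_PE t a b : par_P t a b = t (inr (cell a b)).
Proof. by rewrite /par_P /cell; case: ifP. Qed.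

Lemma cellC a b : cell a b = cell b a.
Proof.
rewrite /cell; case: (ltngtP a b) => //= ab.
by have -> : a = b by exact/val_inj.
Qed.

Definition pi_coords : seq (par_idx k) :=
  map inl (seq.filter (fun a : 'I_k => (a < k.-1)%N) (enum 'I_k)).
Definition P_coords : seq (par_idx k) :=
  map inr (seq.filter (fun ab : 'I_k * 'I_k => (ab.1 <= ab.2)%N)
                  (enum {: 'I_k * 'I_k})).

Lemma uniq_pi_coords : uniq pi_coords.
Proof.
rewrite map_inj_uniq; last by move=> ? ? [].
exact/filter_uniq/enum_uniq.
Qed.

Lemma uniq_P_coords : uniq P_coords.
Proof.
rewrite map_inj_uniq; last by move=> ? ? [].
exact/filter_uniq/enum_uniq.
Qed.

Lemma uniq_par_coords : uniq (par_coords k).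
Proof.
rewrite /par_coords cat_uniq; apply/and3P; split.
- exact: uniq_pi_coords.
- by apply/hasPn => _ /mapP[p _ ->]; apply/negP => /mapP[].
- exact: uniq_P_coords.
Qed.

Lemma big_pi_coords (T : Type) (idx : T) (op : Monoid.com_law idx)
    (g : par_idx k -> T) :
  \big[op/idx]_(i <- pi_coords) g i = \big[op/idx]_(a < k | (a < k.-1)%N) g (inl a).
Proof. by rewrite big_map big_filter big_enum_cond. Qed.

Lemma big_P_coords (T : Type) (idx : T) (op : Monoid.com_law idx)
    (g : par_idx k -> T) :
  \big[op/idx]_(i <- P_coords) g i =
  \big[op/idx]_(p : 'I_k * 'I_k | (p.1 <= p.2)%N) g (inr p).
Proof. by rewrite big_map big_filter big_enum_cond. Qed.

Lemma mem_pi_coords a : (inl a \in pi_coords) = (a < k.-1)%N.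
Proof.
rewrite mem_map; last by move=> ? ? [].
by rewrite mem_filter mem_enum andbT.
Qed.

Lemma mem_P_coords p : (inr p \in P_coords) = (p.1 <= p.2)%N.
Proof.
rewrite mem_map; last by move=> ? ? [].
by rewrite mem_filter mem_enum andbT.
Qed.

Lemma mem_par_coords_inl a : (inl a \in par_coords k) = (a < k.-1)%N.
Proof.
rewrite mem_cat -mem_pi_coords orbC; case: (boolP (_ \in _)) => //.
by move=> /mapP[].
Qed.

Lemma mem_par_coords_inr p : (inr p \in par_coords k) = (p.1 <= p.2)%N.
Proof.
rewrite mem_cat -mem_P_coords; case: (boolP (_ \in map inl _)) => //.
by move=> /mapP[].
Qed.


Lemma prod_par_pi (G : R -> R) t :
  \prod_(a < k) G (par_pi t a) =
  (\prod_(i <- pi_coords) G (t i)) * G (1 - \sum_(i <- pi_coords) t i).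
Proof.
rewrite !big_pi_coords/= (bigID (fun a : 'I_k => (a < k.-1)%N))/=; congr (_ * _).
  by apply: eq_bigr => a ak; rewrite /par_pi ak.
move: hk t; case: (k) => // k' _ t /=.
rewrite (big_pred1 ord_max) => [|a]; first by rewrite /par_pi/= ltnn.
by rewrite /= -leqNgt -val_eqE/= eqn_leq leq_ord.
Qed.

Lemma sum_par_pi t : \sum_(a < k) par_pi t a = 1.
Proof.
rewrite (bigID (fun a : 'I_k => (a < k.-1)%N))/=.
rewrite (eq_bigr (fun a => t (inl a))); last by move=> a ak; rewrite /par_pi ak.
move: hk t; case: (k) => // k' _ t /=.
rewrite [X in _ + X](big_pred1 ord_max) => [|a]; first by rewrite /par_pi/= ltnn addrC subrK.
by rewrite /= -leqNgt -val_eqE/= eqn_leq leq_ord.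
Qed.

Lemma par_pi_ge0 t a : in_cube t -> in_simplex t -> 0 <= par_pi t a.
Proof.
move=> ct st; rewrite /par_pi; case: ifP => _; first by have /andP[] := ct (inl a).
by rewrite subr_ge0.
Qed.

Lemma par_P_itv t a b : in_cube t -> 0 <= par_P t a b <= 1.
Proof. by move=> ct; rewrite par_PE; exact: ct. Qed.

Lemma rmeas_par_pi a : rmeas (fun t : par_idx k -> R => par_pi t a).
Proof.
rewrite /par_pi; case: (a < k.-1)%N; first exact: rmeas_coord.
apply: rmeasB; first exact: rmeas_cst.
by apply: rmeas_sum => b; exact: rmeas_coord.
Qed.

Lemma rmeas_par_P a b : rmeas (fun t : par_idx k -> R => par_P t a b).
Proof. by rewrite /par_P; case: (a <= b)%N; exact: rmeas_coord. Qed.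

Lemma rmeas_prior : rmeas (@prior_dens R k).
Proof.
rewrite /prior_dens; apply: rmeasM; first apply: rmeasM.
- by apply: rmeas_if_le; apply: rmeas_sum => b; exact: rmeas_coord.
- by apply: rmeas_prod => a; apply: rmeas_powR; exact: rmeas_par_pi.
- apply: rmeas_prod => a; apply: rmeas_prod => b; apply: rmeasM.
    by apply: rmeas_powR; exact: rmeas_par_P.
  apply: rmeas_powR; apply: rmeasB; first exact: rmeas_cst.
  exact: rmeas_par_P.
Qed.

Lemma rmeas_joint n (z : 'I_n -> 'I_k) (x : network n) :
  rmeas (fun t : par_idx k -> R => sbm_joint (par_pi t) (par_P t) z x).
Proof.
apply: rmeasM; first by apply: rmeas_prod => i; exact: rmeas_par_pi.
apply: rmeas_prod => i; apply: rmeas_prod => j; case: (x i j).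
  exact: rmeas_par_P.
by apply: rmeasB; [exact: rmeas_cst|exact: rmeas_par_P].
Qed.

Lemma prior_ge0 t : 0 <= prior_dens t.
Proof.
rewrite /prior_dens !mulr_ge0//; first by case: ifP.
- by apply: prodr_ge0 => *; exact: powR_ge0.
- by apply: prodr_ge0 => *; apply: prodr_ge0 => *; rewrite mulr_ge0// powR_ge0.
Qed.

Lemma prior_out t : ~~ in_simplex t -> prior_dens t = 0.
Proof. by move=> /negbTE h; rewrite /prior_dens h !mul0r. Qed.

Lemma prior_cubeE t : in_cube t ->
  prior_dens t = (\prod_(i <- pi_coords) isqrt_pos (t i))
    * isqrt_pos (1 - \sum_(i <- pi_coords) t i)
    * \prod_(i <- P_coords) (isqrt_pos (t i) * isqrt_pos (1 - t i)).
Proof.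
move=> ct; rewrite /prior_dens; congr (_ * _).
  rewrite (prod_par_pi (fun x => x `^ (- 2^-1))) mulrCA; congr (_ * _).
    by apply: eq_bigr => i _; rewrite isqrt_pos_powR//; case/andP: (ct i).
  rewrite /in_simplex -(big_pi_coords (@GRing.add R) (fun i => t i)).
  case: ifPn => h; first by rewrite mul1r isqrt_pos_powR// subr_ge0.
  by rewrite mul0r /isqrt_pos subr_gt0 ltNge (ltW _)//= ltNge.
rewrite big_P_coords pair_big_dep/=; apply: eq_bigr => -[a b] /= ab.
have /andP[h0 h1] := ct (inr (a, b)).
by rewrite /par_P ab !isqrt_pos_powR ?subr_ge0.
Qed.

(** The integrands on which [fine] loses no information: a multiple of the prior bounds them, so
    their integral is finite. Signs and bounds are imposed on the cube only, because a likelihood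
    may be negative outside it. *)
Definition dominated (f : (par_idx k -> R) -> R) :=
  [/\ rmeas f, (forall t, in_cube t -> 0 <= f t) &
      exists B, forall t, in_cube t -> f t <= B * prior_dens t].

Definition prior_int f := fine (int_Theta (k := k) f : \bar R).

Lemma in_cube0 : in_cube (fun _ : par_idx k => 0 : R).
Proof. by move=> i; rewrite lexx ler01. Qed.

(** Monotone integration theory wants functions nonnegative everywhere; the absolute value provides
    this and changes nothing on the cube, where the integration takes place. *)
Lemma int_Theta_norm (f : (par_idx k -> R) -> R) : (forall t, in_cube t -> 0 <= f t) ->
  int_Theta f = int_Theta (fun t => `|f t|).
Proof.
move=> f0; apply: eq_iter_int; first exact: in_cube0.
by move=> t ct; rewrite ger0_norm// f0.
Qed.

Lemma int_Theta_ge0 (f : (par_idx k -> R) -> R) : (forall t, in_cube t -> 0 <= f t) ->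
  (0 <= int_Theta f)%E.
Proof.
by move=> f0; rewrite int_Theta_norm//; apply: iter_int_ge0 => t; rewrite lee_fin.
Qed.

Lemma int_Theta_le (f g : (par_idx k -> R) -> R) :
  rmeas f -> rmeas g ->
  (forall t, in_cube t -> 0 <= f t) ->
  (forall t, in_cube t -> f t <= g t) -> (int_Theta f <= int_Theta g)%E.
Proof.
move=> mf mg f0 fg.
have g0 t : in_cube t -> 0 <= g t by move=> ct; apply: le_trans (fg _ ct); exact: f0.
rewrite int_Theta_norm// [leRHS]int_Theta_norm//; apply: le_iter_int.
- exact: in_cube0.
- by move=> t ct; rewrite lee_fin !ger0_norm// ?f0 ?g0// fg.
- by move=> t; rewrite lee_fin.
- by apply: rmeas_emeas; exact: rmeas_norm.
- by move=> t; rewrite lee_fin.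
- by apply: rmeas_emeas; exact: rmeas_norm.
Qed.

(** The edge parameters are integrated first, by the Beta bound, and the remaining Dirichlet factor
    next. An infinite mass would be sent to 0 by [fine] and make the normalization of [KT]
    meaningless. *)
Lemma int_Theta_prior_lty : (int_Theta (@prior_dens R k) < +oo)%E.
Proof.
rewrite /int_Theta /par_coords iter_int_cat.
pose f t := (prior_dens t : R)%:E.
have f0 t : (0 <= f t)%E by rewrite lee_fin prior_ge0.
have mf : emeas f by apply: rmeas_emeas; exact: rmeas_prior.
have hP t : in_cube t -> (iter_int P_coords f t <= (16 ^+ size P_coords *
    ((\prod_(i <- pi_coords) isqrt_pos (t i)) *
     isqrt_pos (1 - \sum_(i <- pi_coords) t i)))%:E)%E.
  move=> ct; apply: iter_int_beta_le => //.
  - rewrite mulr_ge0 ?isqrt_pos_ge0//; apply: prodr_ge0 => *; exact: isqrt_pos_ge0.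
  - exact: uniq_P_coords.
  - move=> u cu ut; rewrite /f prior_cubeE//.
    have e i : i \in pi_coords -> u i = t i.
      by move=> /mapP[a _ ->]; apply: ut; apply/negP => /mapP[].
    rewrite (eq_big_seq (fun i => isqrt_pos (t i))); last by move=> i /e ->.
    rewrite (_ : \sum_(i <- pi_coords) u i = \sum_(i <- pi_coords) t i)//.
    by apply: eq_big_seq => i /e ->.
apply: (@le_lt_trans _ _ (16 ^+ size pi_coords * 16 ^+ size P_coords * isqrt_pos 1)%:E); last exact: ltry.
apply: iter_int_dirichlet_le => //.
- exact: uniq_pi_coords.
- exact: in_cube0.
- by move=> t ct _; rewrite -mulrA; exact: hP.
- by move=> t; exact: iter_int_ge0.
- exact: measurable_iter_int.
Qed.

Lemma dominated_lty f : dominated f -> (int_Theta f < +oo)%E.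
Proof.
move=> [mf f0 [B fB]].
apply: (@le_lt_trans _ _ (int_Theta (fun t => `|B| * prior_dens t))).
  apply: int_Theta_le => //.
    by apply: rmeasM; [exact: rmeas_cst|exact: rmeas_prior].
  move=> t ct; apply: le_trans (fB _ ct) _.
  by rewrite ler_wpM2r ?prior_ge0// ler_norm.
rewrite /int_Theta (_ : (fun t => _) = (fun t => (`|B|%:E * (prior_dens t)%:E)%E))//.
rewrite iter_intZ//.
- rewrite lte_mul_pinfty// ?lee_fin//; exact: int_Theta_prior_lty.
- by move=> t; rewrite lee_fin prior_ge0.
- by apply: rmeas_emeas; exact: rmeas_prior.
Qed.

Lemma prior_intE f : dominated f -> int_Theta f = (prior_int f)%:E.
Proof.
move=> df; have [_ f0 _] := df.
by rewrite /prior_int fineK// ge0_fin_numE ?dominated_lty// int_Theta_ge0.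
Qed.

Lemma dominated_prior : dominated (@prior_dens R k).
Proof.
split; first exact: rmeas_prior.
- by move=> *; exact: prior_ge0.
- by exists 1 => t _; rewrite mul1r.
Qed.

Lemma prior_int_le f g : dominated f -> dominated g ->
  (forall t, in_cube t -> f t <= g t) -> prior_int f <= prior_int g.
Proof.
move=> df dg fg; rewrite -lee_fin -!prior_intE//.
have [mf f0 _] := df; have [mg _ _] := dg; exact: int_Theta_le.
Qed.

Lemma dominated_sum (J : Type) (r : seq J) (P : pred J) f :
  (forall j, dominated (f j)) -> dominated (fun t => \sum_(j <- r | P j) f j t).
Proof.
move=> df; split.
- by apply: rmeas_sum => j; have [] := df j.
- by move=> t ct; apply: sumr_ge0 => j _; have [_ + _] := df j; exact.
- have hB j : exists B, forall t, in_cube t -> f j t <= B * prior_dens t by have [] := df j.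
  have [B hB'] := choice hB.
  exists (\sum_(j <- r | P j) B j) => t ct; rewrite mulr_suml.
  by apply: ler_sum => j _; exact: hB'.
Qed.

Lemma prior_int_sum (J : Type) (r : seq J) (P : pred J) f :
  (forall j, dominated (f j)) ->
  prior_int (fun t => \sum_(j <- r | P j) f j t) = \sum_(j <- r | P j) prior_int (f j).
Proof.
move=> df; apply: EFin_inj; rewrite -prior_intE; last exact: dominated_sum.
rewrite -sumEFin (eq_bigr (fun j => int_Theta (fun t => `|f j t|))); last first.
  by move=> j _; rewrite -prior_intE// int_Theta_norm//; have [] := df j.
rewrite -iter_int_sum.
- apply: eq_iter_int; first exact: in_cube0.
  move=> t ct; rewrite sumEFin; congr EFin; apply: eq_bigr => j _.
  by rewrite ger0_norm//; have [_ + _] := df j; exact.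
- by move=> j t; rewrite lee_fin.
- by move=> j; apply: rmeas_emeas; apply: rmeas_norm; have [] := df j.
Qed.

Lemma dominatedZ c f : 0 <= c -> dominated f -> dominated (fun t => c * f t).
Proof.
move=> c0 [mf f0 [B fB]]; split.
- by apply: rmeasM => //; exact: rmeas_cst.
- by move=> t ct; rewrite mulr_ge0// f0.
- by exists (c * B) => t ct; rewrite -mulrA ler_wpM2l// fB.
Qed.

Lemma prior_intZ c f : 0 <= c -> dominated f ->
  prior_int (fun t => c * f t) = c * prior_int f.
Proof.
move=> c0 df; apply: EFin_inj; rewrite -prior_intE; last exact: dominatedZ.
have [mf f0 _] := df.
rewrite EFinM -prior_intE// (int_Theta_norm f0) /int_Theta -iter_intZ//.
- apply: eq_iter_int; first exact: in_cube0.
  by move=> t ct; rewrite -EFinM ger0_norm// f0.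
- by apply: rmeas_emeas; exact: rmeas_norm.
Qed.

Lemma prior_int_box f (l r : par_idx k -> R) (V : R) : dominated f -> 0 <= V ->
  (forall i, i \in par_coords k -> [&& 0 <= l i, l i <= r i & r i <= 1]) ->
  (forall t, in_cube t -> (forall i, i \in par_coords k -> l i <= t i <= r i) -> V <= f t) ->
  V * ((\prod_(i <- pi_coords) (r i - l i)) * \prod_(i <- P_coords) (r i - l i))
    <= prior_int f.
Proof.
move=> df V0 lr hV; have [mf f0 _] := df.
rewrite -lee_fin -prior_intE// int_Theta_norm// -big_cat/=.
apply: (@iter_int_box R _ _ _ _ l r) => //.
- exact: uniq_par_coords.
- move=> t tb t0; have ct : in_cube t.
    move=> i; case: (boolP (i \in par_coords k)) => [ic|/t0 ->]; last by rewrite lexx ler01.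
    have /andP[h1 h2] := tb i ic; have /and3P[h3 h4 h5] := lr i ic.
    by rewrite (le_trans h3 h1) (le_trans h2 h5).
  by rewrite lee_fin ger0_norm ?f0// hV.
- by apply: rmeas_emeas; exact: rmeas_norm.
Qed.

End Prior.

(** * Likelihood ratios and chi-square bounds *)

Section Gibbs.
Variable R : realType.
Implicit Types (p q N : R).

Lemma le_expR_subr1 (x : R) : x <= expR (x - 1).
Proof. by have := @expR_ge1Dx R (x - 1); rewrite addrC subrK. Qed.

(** Passing through the empirical frequency c / N, write p0 / p as (N p0 / c) (c / (N p)), bound
    each factor by x <= exp(x - 1), and take the power c. Summed over the outcomes, the terms N p0
    give N and no longer depend on p0. *)
Lemma gibbs_term (c : nat) N p0 p : 0 < N -> 0 <= p0 -> 0 < p ->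
  p0 ^+ c <= p ^+ c * expR (N * p0 - 2 * c%:R + c%:R ^+ 2 / (N * p)).
Proof.
move=> N0 p00 pp; case: c => [|c].
  by rewrite !expr0 mul1r -expR0 ler_expR mulr0 subr0 expr0n/= mul0r addr0 mulr_ge0// ltW.
have c0 : 0 < c.+1%:R :> R by rewrite ltr0n.
have h : p0 <= p * expR (p0 * N / c.+1%:R - 1 + (c.+1%:R / (N * p) - 1)).
  rewrite expRD.
  have -> : p0 = p * ((p0 * N / c.+1%:R) * (c.+1%:R / (N * p))).
    by field; rewrite !gt_eqF.
  rewrite ler_pM2l//.
  have -> : p * (p0 * N / c.+1%:R * (c.+1%:R / (N * p))) = p0.
    by field; rewrite !gt_eqF.
  apply: ler_pM; rewrite ?le_expR_subr1//.
  - by rewrite !mulr_ge0 ?invr_ge0// ltW.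
  - by rewrite mulr_ge0 ?invr_ge0 ?mulr_ge0// ltW.
apply: le_trans (lerXn2r c.+1 _ _ h) _.
- by rewrite nnegrE.
- by rewrite nnegrE mulr_ge0 ?expR_ge0// ltW.
rewrite exprMn -expRM_natl; rewrite ler_pM2l ?exprn_gt0// ler_expR.
by rewrite le_eqVlt; apply/orP; left; apply/eqP; field; rewrite !gt_eqF.
Qed.

(* The exponent is N times the chi-square divergence of p from c / N. *)
Lemma gibbs_prod (I : finType) (c : I -> nat) (p0 p : I -> R) N :
  N = (\sum_i c i)%:R -> 0 < N ->
  (forall i, 0 <= p0 i) -> \sum_i p0 i = 1 ->
  (forall i, 0 < p i) -> \sum_i p i = 1 ->
  \prod_i p0 i ^+ c i <=
  \prod_i p i ^+ c i * expR (\sum_i ((c i)%:R - N * p i) ^+ 2 / (N * p i)).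
Proof.
move=> NE N0 p00 p01 pp p1.
apply: (@le_trans _ _ (\prod_i (p i ^+ c i *
    expR (N * p0 i - 2 * (c i)%:R + (c i)%:R ^+ 2 / (N * p i))))).
  by apply: ler_prod => i _; rewrite exprn_ge0//=; exact: gibbs_term.
rewrite big_split/= -expR_sum ler_wpM2l//; first by apply: prodr_ge0 => i _; rewrite exprn_ge0// ltW.
rewrite ler_expR.
have e (i : I) : ((c i)%:R - N * p i) ^+ 2 / (N * p i) =
    (c i)%:R ^+ 2 / (N * p i) - 2 * (c i)%:R + N * p i.
  by field; rewrite !gt_eqF.
rewrite (eq_bigr _ (fun i _ => e i)) !big_split/= -!mulr_sumr p1 p01 !sumrN.
by rewrite -!mulr_sumr -natr_sum -NE; lra.
Qed.

Lemma gibbs_bernoulli (o j : nat) (p0 p : R) : (0 < o + j)%N ->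
  0 <= p0 <= 1 -> 0 < p < 1 ->
  p0 ^+ o * (1 - p0) ^+ j <= p ^+ o * (1 - p) ^+ j *
    expR ((o%:R - (o + j)%:R * p) ^+ 2 / ((o + j)%:R * (p * (1 - p)))).
Proof.
move=> oj /andP[p00 p01] /andP[pp p1].
have N0 : 0 < (o + j)%:R :> R by rewrite ltr0n.
have := @gibbs_prod bool (fun b => if b then o else j)
  (fun b => if b then p0 else 1 - p0) (fun b => if b then p else 1 - p) (o + j)%:R.
rewrite !big_bool/=; move=> /(_ erefl N0) h.
apply: le_trans (h _ _ _ _) _.
- by case; rewrite ?subr_ge0.
- by rewrite addrC subrK.
- by case; rewrite ?subr_gt0.
- by rewrite addrC subrK.
rewrite ler_pM2l; last by rewrite mulr_gt0 ?exprn_gt0// subr_gt0.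
rewrite ler_expR le_eqVlt; apply/orP; left; apply/eqP.
move: N0; rewrite natrD; set x := o%:R; set y := j%:R => N0.
by field; rewrite !gt_eqF// subr_gt0.
Qed.

End Gibbs.

(** * A box of posterior width for one edge parameter *)

Section BetaBox.
Variable R : realType.
Variables (o j : nat).
Let m : R := (o + j)%:R.

(** The mean of Beta(o + 1, j + 1). Unlike the frequency o / (o + j), it stays at least 1 / (o + j +
    2) away from 0 and 1. [beta_d] is about half a posterior standard deviation. *)
Definition beta_l : R := o.+1%:R / (o + j).+2%:R.
Definition beta_d : R := 2^-1 * Num.sqrt (beta_l * (1 - beta_l) / (o + j).+2%:R).

Let a := beta_l.
Let d := beta_d.
Let w : R := (o + j).+2%:R^-1.

Lemma beta_w : [/\ 0 < w, w <= a, w <= 1 - a, 0 < a & 0 < 1 - a].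
Proof.
have M0 : 0 < (o + j).+2%:R :> R by rewrite ltr0n.
have w0 : 0 < w by rewrite invr_gt0.
have wa : w <= a by rewrite /a /beta_l -[leLHS]mul1r ler_wpM2r ?(ltW w0)// ler1n.
have e : 1 - a = j.+1%:R * w.
  apply: (mulIf (lt0r_neq0 M0)); rewrite mulrBl mul1r /a /beta_l /w mulfVK ?gt_eqF//.
  by rewrite mulfVK ?gt_eqF// -!natr1 !natrD; ring.
have wb : w <= 1 - a by rewrite e -[leLHS]mul1r ler_wpM2r ?(ltW w0)// ler1n.
by split => //; apply: lt_le_trans w0 _.
Qed.

Lemma beta_d_gt0 : 0 < d.
Proof.
have [w0 _ _ a0 b0] := beta_w.
by rewrite /d /beta_d mulr_gt0 ?invr_gt0// sqrtr_gt0 !mulr_gt0.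
Qed.

Lemma beta_d_sqr : d ^+ 2 = a * (1 - a) * w / 4.
Proof.
have [w0 _ _ a0 b0] := beta_w.
rewrite /d /beta_d exprMn sqr_sqrtr; last by rewrite !mulr_ge0// ltW.
by rewrite -/a -/w; field.
Qed.

(** Since w is at most both a and 1 - a, the square a (1 - a) w / 4 is below a^2 / 4 and (1 - a)^2 /
    4. As a consequence p (1 - p) is comparable with a (1 - a) throughout the box. *)
Lemma beta_d_le : d <= a / 2 /\ d <= (1 - a) / 2.
Proof.
have [w0 wa wb a0 b0] := beta_w; have d0 := beta_d_gt0; have e := beta_d_sqr.
have h1 : a * (1 - a) * w <= a * a.
  by rewrite -mulrA ler_pM2l//; apply: le_trans wa; rewrite ler_piMl ?(ltW w0)//; lra.
have h2 : a * (1 - a) * w <= (1 - a) * (1 - a).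
  rewrite mulrAC ler_pM2r//; apply: le_trans wb; rewrite ler_piMl ?(ltW w0)//; lra.
split; rewrite -(@ler_pXn2r _ 2) ?nnegrE ?(ltW d0)//;
  first [by lra|by rewrite e expr2; lra].
Qed.

Lemma beta_box_itv : [&& 0 <= a, a <= a + d & a + d <= 1].
Proof.
have [w0 _ _ a0 b0] := beta_w; have d0 := beta_d_gt0; have [_ h] := beta_d_le.
by apply/and3P; split; lra.
Qed.

(** The width is proportional to the root of a (1 - a) / (o + j + 2) and the Beta density is the
    inverse root of p (1 - p), so their product does not degenerate near 0 or 1: this is the factor
    1/3. The exponent 25 bounds the chi-square divergence on the box. *)
Lemma beta_box (p p0 : R) : a <= p <= a + d -> 0 <= p0 <= 1 ->
  p0 ^+ o * (1 - p0) ^+ j * (expR (- 25) / 3) <=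
  d * Num.sqrt (o + j).+2%:R *
    (p ^+ o * (1 - p) ^+ j * (isqrt_pos p * isqrt_pos (1 - p))).
Proof.
move=> /andP[ap pd] p0i.
have [w0 wa wb a0 b0] := beta_w; have d0 := beta_d_gt0; have e := beta_d_sqr.
have [da db] := beta_d_le.
have M0 : 0 < (o + j).+2%:R :> R by rewrite ltr0n.
have pp : 0 < p by lra.
have q0 : 0 < 1 - p by lra.
have pqu : p * (1 - p) <= 3 / 2 * (a * (1 - a)).
  rewrite mulrA; apply: ler_pM; lra.
have pql : a * (1 - a) / 2 <= p * (1 - p).
  rewrite -mulrA; apply: ler_pM; lra.
have s0 : 0 < a * (1 - a) by rewrite mulr_gt0.
have pq0 : 0 < p * (1 - p) by rewrite mulr_gt0.
have dens : 3^-1 <= d * Num.sqrt (o + j).+2%:R * (isqrt_pos p * isqrt_pos (1 - p)).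
  rewrite !isqrt_posE// -invfM -sqrtrM ?(ltW pp)// ler_pdivlMr ?sqrtr_gt0//.
  rewrite -(@ler_pXn2r _ 2) ?nnegrE ?mulr_ge0 ?sqrtr_ge0 ?invr_ge0 ?(ltW d0)//.
  rewrite [in leLHS]exprMn [in leRHS]exprMn !sqr_sqrtr ?(ltW pq0)// ?(ltW M0)// e.
  have -> : a * (1 - a) * w / 4 * (o + j).+2%:R = a * (1 - a) / 4.
    by rewrite /w; field; rewrite gt_eqF.
  by rewrite expr2; lra.
have lik : p0 ^+ o * (1 - p0) ^+ j * expR (- 25) <= p ^+ o * (1 - p) ^+ j.
  (* Without observations the chi-square expression would divide by zero; both likelihoods are then
     1. *)
  have [oj|oj] := posnP (o + j)%N.
    have [oz jz] : o = 0%N /\ j = 0%N.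
      by move: oj => /eqP; rewrite addn_eq0 => /andP[/eqP ? /eqP ?].
    rewrite oz jz.
    by rewrite !expr0 !mul1r -[leRHS]expR0 ler_expR; lra.
  have m1 : 1 <= m by rewrite /m ler1n.
  have := @gibbs_bernoulli R o j p0 p oj p0i.
  rewrite pp -subr_gt0 q0 => /(_ isT) h.
  rewrite expRN ler_pdivrMr ?expR_gt0//; apply: le_trans h _.
  rewrite ler_pM2l; last by rewrite mulr_gt0 ?exprn_gt0.
  rewrite ler_expR -/m ler_pdivrMr; last by rewrite mulr_gt0//; lra.
  have oE : o%:R = a * (m + 2) - 1.
    rewrite /a /beta_l (_ : (o + j).+2%:R = m + 2); last by rewrite /m -addn2 natrD.
    have m20 : m + 2 != 0 by rewrite gt_eqF//; lra.
    by rewrite mulfVK// -natr1 addrK.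
  have wE : w * (m + 2) = 1.
    rewrite /w (_ : (o + j).+2%:R = m + 2); last by rewrite /m -addn2 natrD.
    by rewrite mulVf// gt_eqF//; lra.
  (* The first term is the bias of the smoothed mean, at most 1 in absolute value; the second is the
     displacement inside the box. *)
  have -> : o%:R - m * p = (2 * a - 1) - m * (p - a) by rewrite oE; ring.
  set u := p - a.
  have u0 : 0 <= u by rewrite /u; lra.
  have ud : u <= d by rewrite /u; lra.
  have u2 : u ^+ 2 <= a * (1 - a) * w / 4 by rewrite -e lerXn2r// nnegrE// ltW.
  have sq : (2 * a - 1 - m * u) ^+ 2 <= 2 + 2 * (m * m) * u ^+ 2.
    have : 0 <= (2 * a - 1 + m * u) ^+ 2 by exact: sqr_ge0.
    have : (2 * a - 1) ^+ 2 <= 1.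
      have -> : (2 * a - 1) ^+ 2 = 1 - 4 * (a * (1 - a)) by ring.
      lra.
    rewrite !expr2; lra.
  apply: le_trans sq _.
  have ws : w / 2 <= a * (1 - a).
    have [a2|a2] := leP a 2^-1.
      have : w * 2^-1 <= a * (1 - a) by apply: ler_pM; lra.
      by [].
    have : 2^-1 * w <= a * (1 - a) by apply: ler_pM; lra.
    by rewrite mulrC.
  have mw : m * w <= 1.
    have : m * w + 2 * w = 1 by rewrite -[RHS]wE; ring.
    lra.
  have m3 : 1 <= 3 * (m * w).
    have : m * w + 2 * w = 1 by rewrite -[RHS]wE; ring.
    have : w <= m * w by rewrite ler_peMl// ltW.
    lra.
  (* 25 m p q >= 12 m s + m s / 2, where s = a (1 - a) >= w / 2 *)
  have h1 : 2 * (m * m) * u ^+ 2 <= m * (a * (1 - a)) / 2.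
    apply: (@le_trans _ _ (2 * (m * m) * (a * (1 - a) * w / 4))).
      by rewrite ler_wpM2l// !mulr_ge0//; lra.
    have : m * w * (m * (a * (1 - a))) <= 1 * (m * (a * (1 - a))).
      by rewrite ler_wpM2r// mulr_ge0//; lra.
    lra.
  have h2 : 2 <= 12 * (m * (a * (1 - a))).
    have : m * (w / 2) <= m * (a * (1 - a)) by rewrite ler_wpM2l//; lra.
    lra.
  have h3 : m * (a * (1 - a) / 2) <= m * (p * (1 - p)) by rewrite ler_wpM2l//; lra.
  lra.
rewrite mulrA; apply: le_trans (ler_pM _ _ lik dens) _.
- by rewrite !mulr_ge0 ?exprn_ge0 ?expR_ge0//; lra.
- by rewrite invr_ge0.
by rewrite le_eqVlt; apply/orP; left; apply/eqP; ring.
Qed.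

End BetaBox.

(** * Lower bound for the integrated likelihood *)

Lemma prod_le1 (R : realType) (I : Type) (r : seq I) (P : pred I) (F : I -> R) :
  (forall i, P i -> 0 <= F i <= 1) -> \prod_(i <- r | P i) F i <= 1.
Proof.
move=> h; suff /andP[] : 0 <= \prod_(i <- r | P i) F i <= 1 by [].
elim/big_ind : _ => //; first by rewrite ler01 lexx.
by move=> x y /andP[? ?] /andP[? ?]; rewrite mulr_ge0//= mulr_ile1.
Qed.

Section Cells.
Variables (R : realType) (n k : nat).
Implicit Types (z : 'I_n -> 'I_k) (x : network n) (T : 'I_k * 'I_k -> R).

Definition edge_cell z (e : 'I_n * 'I_n) := cell (z e.1) (z e.2).

Definition n_present z x p :=
  #|[pred e : 'I_n * 'I_n | [&& (e.1 < e.2)%N, edge_cell z e == p & x e.1 e.2]]|.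
Definition n_absent z x p :=
  #|[pred e : 'I_n * 'I_n | [&& (e.1 < e.2)%N, edge_cell z e == p & ~~ x e.1 e.2]]|.
Definition n_class z a := #|[pred i | z i == a]|.

Definition edge_lik T z x : R :=
  \prod_(e : 'I_n * 'I_n | (e.1 < e.2)%N)
    (if x e.1 e.2 then T (edge_cell z e) else 1 - T (edge_cell z e)).

Lemma sbm_jointE (pi : 'I_k -> R) P T z x : (forall a b, P a b = T (cell a b)) ->
  sbm_joint pi P z x = (\prod_i pi (z i)) * edge_lik T z x.
Proof.
move=> PT; rewrite /sbm_joint pair_big_dep/=; congr (_ * _).
by apply: eq_bigr => e _; rewrite PT.
Qed.

Lemma edge_lik_cells T z x :
  edge_lik T z x = \prod_p (T p ^+ n_present z x p * (1 - T p) ^+ n_absent z x p).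
Proof.
rewrite /edge_lik (partition_big (edge_cell z) xpredT)//=.
apply: eq_bigr => p _; rewrite (bigID (fun e : 'I_n * 'I_n => x e.1 e.2))/=; congr (_ * _).
- rewrite (eq_bigr (fun=> T p)); last by move=> e /andP[/andP[_ /eqP ->] ->].
  rewrite prodr_const; congr (_ ^+ _); apply: eq_card => e.
  by rewrite [LHS]unfold_in [RHS]unfold_in/= -andbA.
- rewrite (eq_bigr (fun=> 1 - T p)); last by move=> e /andP[/andP[_ /eqP ->] /negbTE ->].
  rewrite prodr_const; congr (_ ^+ _); apply: eq_card => e.
  by rewrite [LHS]unfold_in [RHS]unfold_in/= -andbA.
Qed.

Lemma cell_le (a b : 'I_k) : ((cell a b).1 <= (cell a b).2)%N.
Proof. by rewrite /cell; case: ifPn => //=; rewrite -ltnNge => /ltnW. Qed.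

Lemma edge_lik_ocells T z x :
  edge_lik T z x = \prod_(p : 'I_k * 'I_k | (p.1 <= p.2)%N)
    (T p ^+ n_present z x p * (1 - T p) ^+ n_absent z x p).
Proof.
rewrite edge_lik_cells (bigID (fun p : 'I_k * 'I_k => (p.1 <= p.2)%N))/=.
rewrite [X in _ * X]big1 ?mulr1// => p pp.
have h (Q : pred ('I_n * 'I_n)) :
    #|[pred e : 'I_n * 'I_n | [&& (e.1 < e.2)%N, edge_cell z e == p & Q e]]| = 0%N.
  apply: eq_card0 => e; rewrite !inE; apply/negP => /and3P[_ /eqP ep _].
  by move: pp; rewrite -ep cell_le.
by rewrite /n_present /n_absent (h (fun e => x e.1 e.2)) (h (fun e => ~~ x e.1 e.2)) !expr0 mulr1.
Qed.

Lemma prod_class (pi : 'I_k -> R) z :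
  \prod_i pi (z i) = \prod_a pi a ^+ n_class z a.
Proof.
rewrite (partition_big z xpredT)//=; apply: eq_bigr => a _.
rewrite (eq_bigr (fun=> pi a)); last by move=> i /eqP ->.
by rewrite prodr_const.
Qed.

Lemma sum_class z : (\sum_a n_class z a = n)%N.
Proof.
rewrite -[RHS]card_ord -sum1_card (partition_big z xpredT)//=.
by apply: eq_bigr => a _; rewrite sum1_card.
Qed.

Lemma n_cell_le z x p : (n_present z x p + n_absent z x p <= n * n)%N.
Proof.
rewrite /n_present /n_absent -[X in (_ <= X * X)%N]card_ord -card_prod.
rewrite -cardUI [X in (_ + X)%N]eq_card0 ?addn0 ?max_card// => e.
by rewrite !inE; case: (x e.1 e.2); rewrite ?andbF.
Qed.

Lemma edge_lik_ge0 T z x : (forall p, 0 <= T p <= 1) -> 0 <= edge_lik T z x.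
Proof.
move=> T01; apply: prodr_ge0 => e _; have /andP[h0 h1] := T01 (edge_cell z e).
by case: ifP; rewrite ?subr_ge0.
Qed.

Lemma edge_lik_le1 T z x : (forall p, 0 <= T p <= 1) -> edge_lik T z x <= 1.
Proof.
move=> T01; apply: prod_le1 => e _; have /andP[h0 h1] := T01 (edge_cell z e).
case: ifP => _; first by rewrite h0.
by rewrite subr_ge0 h1/= gerBl.
Qed.

Lemma joint_itv (pi : 'I_k -> R) P z x :
  (forall a, 0 <= pi a) -> \sum_a pi a = 1 -> (forall a b, P a b = P b a) ->
  (forall a b, 0 <= P a b <= 1) -> 0 <= sbm_joint pi P z x <= 1.
Proof.
move=> pi0 pi1 sP P01.
have T01 p : 0 <= P p.1 p.2 <= 1 by exact: P01.
rewrite (@sbm_jointE _ _ (fun p => P p.1 p.2)); last first.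
  by move=> a b; rewrite /cell; case: ifP.
rewrite mulr_ge0 ?edge_lik_ge0//=; last exact: prodr_ge0.
rewrite mulr_ile1 ?edge_lik_ge0 ?edge_lik_le1//; first exact: prodr_ge0.
apply: prod_le1 => i _; rewrite pi0/= -pi1 (bigD1 (z i))//= lerDl.
exact: sumr_ge0.
Qed.

Hypothesis hk : (0 < k)%N.

Lemma cube_joint_itv t z x : in_cube t -> in_simplex t ->
  0 <= sbm_joint (R := R) (par_pi t) (par_P t) z x <= 1.
Proof.
move=> ct st; apply: joint_itv.
- by move=> a; exact: par_pi_ge0.
- exact: sum_par_pi.
- by move=> a b; rewrite !par_PE cellC.
- by move=> a b; exact: par_P_itv.
Qed.

Lemma dominated_joint z x :
  dominated (fun t : par_idx k -> R =>
    sbm_joint (par_pi t) (par_P t) z x * prior_dens t).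
Proof.
split.
- by apply: rmeasM; [exact: rmeas_joint|exact: rmeas_prior].
- move=> t ct; have [st|st] := boolP (in_simplex t); last by rewrite prior_out// mulr0.
  by have /andP[h _] := cube_joint_itv z x ct st; rewrite mulr_ge0// prior_ge0.
- exists 1 => t ct; have [st|st] := boolP (in_simplex t); last by rewrite prior_out// !mulr0.
  by have /andP[_ h] := cube_joint_itv z x ct st; rewrite ler_wpM2r ?prior_ge0.
Qed.

End Cells.

(** * The product box and the resulting bound on one labelling *)

Section Lower.
Variables (R : realType) (n k K : nat).
Hypotheses (hn : (0 < n)%N) (hk : (0 < k)%N) (hK : (0 < K)%N).

Lemma size_pi_coords : size (pi_coords k) = k.-1.
Proof.
have := big_pi_coords (k := k) addn (fun _ => 1%N).
rewrite sum1_size => ->; move: hk; case: (k) => // k' _ /=.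
by rewrite -(big_ord_widen k'.+1 (fun=> 1%N) (leqnSn k')) sum1_card card_ord.
Qed.

Lemma size_P_coords : (2 * size (P_coords k) = k * k.+1)%N.
Proof.
have := big_P_coords (k := k) addn (fun _ => 1%N).
rewrite sum1_size => ->.
rewrite -(pair_big_dep xpredT (fun a b : 'I_k => (a <= b)%N) (fun _ _ => 1%N))/=.
have e (a : 'I_k) : (\sum_(b < k | (a <= b)%N) 1 = k - a)%N.
  rewrite (eq_bigl (fun b : 'I_k => ~~ (b < a)%N)); last by move=> b; rewrite -leqNgt.
  have : (\sum_(b < k) 1 = k)%N by rewrite sum1_card card_ord.
  rewrite (bigID (fun b : 'I_k => (b < a)%N))/=.
  rewrite [X in (X + _)%N](_ : _ = nat_of_ord a); first by move=> h; rewrite -[LHS](addKn a) h.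
  rewrite -(big_ord_widen k (fun=> 1%N) (ltnW (ltn_ord a))).
  by rewrite sum1_card card_ord.
rewrite (eq_bigr _ (fun a _ => e a)).
rewrite -(big_mkord xpredT (fun a => k - a)%N).
elim: {e} (k) => [|m IH]; first by rewrite big_nil.
rewrite big_nat_recl// subn0 (eq_bigr (fun a => m - a)%N); last by move=> a _; rewrite subSS.
by rewrite mulnDr IH; ring.
Qed.

Variables (z : 'I_n -> 'I_k) (x : network n).
Hypothesis typ : forall a, (n <= K * n_class z a)%N.

Let rn : R := Num.sqrt n%:R.
Let D : R := (2 * K%:R * rn)^-1.

(** In the class coordinates the box extends upwards from the empirical frequencies, with side D /
    k. The dependent last probability absorbs all increments, hence drops by at most D <= 1 / (2 K),
    half of the smallest frequency that [typ] allows. *)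
Definition box_l (i : par_idx k) : R := match i with
  | inl a => (n_class z a)%:R / n%:R
  | inr p => beta_l R (n_present z x p) (n_absent z x p)
  end.
Definition box_r (i : par_idx k) : R := match i with
  | inl a => (n_class z a)%:R / n%:R + (2 * K%:R * Num.sqrt n%:R)^-1 / k%:R
  | inr p => beta_l R (n_present z x p) (n_absent z x p)
             + beta_d R (n_present z x p) (n_absent z x p)
  end.

Let n0 : 0 < n%:R :> R. Proof. by rewrite ltr0n. Qed.
Let k0 : 0 < k%:R :> R. Proof. by rewrite ltr0n. Qed.
Let K0 : 0 < K%:R :> R. Proof. by rewrite ltr0n. Qed.
Let rn1 : 1 <= rn. Proof. by rewrite /rn -[leLHS]sqrtr1 ler_wsqrtr// ler1n. Qed.
Let rn2 : rn * rn = n%:R. Proof. by rewrite -expr2 sqr_sqrtr// ltW. Qed.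
Let D0 : 0 < D.
Proof. by rewrite /D invr_gt0 !mulr_gt0//; apply: lt_le_trans rn1. Qed.
Let DK : D <= (2 * K%:R)^-1.
Proof.
rewrite /D lef_pV2 ?posrE ?mulr_gt0//; last by apply: lt_le_trans rn1.
by rewrite ler_peMr// mulr_ge0// ltW.
Qed.
Let freq a : K%:R^-1 <= (n_class z a)%:R / n%:R :> R.
Proof.
rewrite ler_pdivlMr// mulrC ler_pdivrMr// -natrM ler_nat mulnC; exact: typ.
Qed.
Let K2 : K%:R^-1 = 2 * (2 * K%:R)^-1 :> R.
Proof. by field; rewrite gt_eqF. Qed.
Let sum_freq : \sum_a (n_class z a)%:R / n%:R = 1 :> R.
Proof. by rewrite -mulr_suml -natr_sum sum_class divff// gt_eqF. Qed.

Lemma exists_last : exists b : 'I_k, ~~ (b < k.-1)%N.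
Proof.
have h : (k.-1 < k)%N by rewrite prednK.
by exists (Ordinal h); rewrite /= ltnn.
Qed.

Lemma box_itv i : i \in par_coords k ->
  [&& 0 <= box_l i, box_l i <= box_r i & box_r i <= 1].
Proof.
case: i => [a|p]; last by move=> _; exact: beta_box_itv.
rewrite mem_par_coords_inl => ak /=.
have [b bk] := exists_last.
have ab : a != b by apply: contraNneq bk => <-.
have Dk : 0 < D / k%:R by rewrite divr_gt0.
have Dk1 : D / k%:R <= D by rewrite ler_pdivrMr// ler_peMr ?(ltW D0)// ler1n.
apply/and3P; split.
- by rewrite divr_ge0.
- by rewrite lerDl ltW.
- rewrite -/rn -/D -[leRHS]sum_freq (bigD1 a)//= lerD2l (bigD1 b) 1?eq_sym//=.
  have h := freq b.
  have : 0 <= \sum_(i < k | (i != a) && (i != b)) (n_class z i)%:R / n%:R :> R.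
    by apply: sumr_ge0 => c _; rewrite divr_ge0.
  by move: h DK K2 D0 Dk1; lra.
Qed.

Lemma box_pi t a : (forall i, i \in par_coords k -> box_l i <= t i <= box_r i) ->
  `|par_pi t a - (n_class z a)%:R / n%:R| <= D.
Proof.
move=> tb.
have h (c : 'I_k) : (c < k.-1)%N ->
    0 <= t (inl c) - (n_class z c)%:R / n%:R <= D / k%:R.
  move=> ck; have /= := tb (inl c); rewrite mem_par_coords_inl => /(_ ck) /andP[h1 h2].
  by rewrite -/rn -/D in h2; apply/andP; split; lra.
have Dk1 : D / k%:R <= D by rewrite ler_pdivrMr// ler_peMr ?(ltW D0)// ler1n.
rewrite /par_pi; case: ifPn => ak.
  by have /andP[h1 h2] := h a ak; rewrite ger0_norm//; lra.
have -> : 1 - \sum_(b < k | (b < k.-1)%N) t (inl b) - (n_class z a)%:R / n%:R =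
    - \sum_(b < k | (b < k.-1)%N) (t (inl b) - (n_class z b)%:R / n%:R).
  have e1 : \sum_(b < k | (b < k.-1)%N) (n_class z b)%:R / n%:R
      + (n_class z a)%:R / n%:R = 1 :> R; last by rewrite sumrB -[X in X - _ - _]e1; ring.
  rewrite -[RHS]sum_freq [RHS](bigID (fun b : 'I_k => (b < k.-1)%N))/=; congr (_ + _).
  rewrite (big_pred1 a)// => b /=.
  move: ak; rewrite -!leqNgt -val_eqE/= => ak.
  have bl : (b <= k.-1)%N by rewrite -ltnS prednK.
  have al : (a <= k.-1)%N by rewrite -ltnS prednK.
  have -> : (a : nat) = k.-1 by apply/eqP; rewrite eqn_leq al.
  by rewrite eqn_leq bl.
rewrite normrN ger0_norm; last by apply: sumr_ge0 => b bk; have /andP[] := h b bk.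
apply: (@le_trans _ _ (\sum_(b < k | (b < k.-1)%N) D / k%:R)).
  by apply: ler_sum => b bk; have /andP[] := h b bk.
apply: (@le_trans _ _ (\sum_(b < k) D / k%:R)).
  by rewrite [leRHS](bigID (fun b : 'I_k => (b < k.-1)%N))/= lerDl sumr_ge0// => *; rewrite divr_ge0// ltW.
by rewrite sumr_const card_ord -[leLHS]mulr_natr mulfVK// gt_eqF.
Qed.

Lemma box_pi_lower t a : (forall i, i \in par_coords k -> box_l i <= t i <= box_r i) ->
  (2 * K%:R)^-1 <= par_pi t a.
Proof.
move=> tb; have := box_pi a tb; rewrite ler_norml => /andP[h _].
by have := freq a; have := DK; lra.
Qed.

Lemma box_simplex t : (forall i, i \in par_coords k -> box_l i <= t i <= box_r i) ->
  in_simplex t.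
Proof.
move=> tb; have [b bk] := exists_last.
have := box_pi_lower b tb; rewrite /par_pi (negbTE bk) => h.
rewrite /in_simplex; have : 0 < (2 * K%:R)^-1 :> R by rewrite invr_gt0 mulr_gt0.
lra.
Qed.

Variable pi0 : 'I_k -> R.
Variable T0 : 'I_k * 'I_k -> R.
Hypotheses (pi0_ge0 : forall a, 0 <= pi0 a) (pi0_sum : \sum_a pi0 a = 1).
Hypothesis T01 : forall p, 0 <= T0 p <= 1.

(** Each class contributes at most n D^2 / pi_a to the chi-square exponent. Here n D^2 = 1 / (4 K^2)
    and pi_a >= 1 / (2 K), so every term is at most 1 and the sum at most k. *)
Lemma box_class t : (forall i, i \in par_coords k -> box_l i <= t i <= box_r i) ->
  \prod_i pi0 (z i) * expR (- k%:R) <= \prod_i par_pi t (z i).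
Proof.
move=> tb; rewrite expRN ler_pdivrMr ?expR_gt0// !prod_class.
have pK a := box_pi_lower a tb.
have iK : 0 < (2 * K%:R)^-1 :> R by rewrite invr_gt0 mulr_gt0.
have pp a : 0 < par_pi t a by apply: lt_le_trans (pK a).
apply: le_trans (@gibbs_prod R _ (n_class z) pi0 (par_pi t) n%:R _ n0 pi0_ge0 pi0_sum pp _) _.
- by rewrite sum_class.
- exact: sum_par_pi.
rewrite ler_pM2l; last by apply: prodr_gt0 => a _; rewrite exprn_gt0.
rewrite ler_expR -[leRHS](_ : \sum_(a < k) (1 : R) = _); last by rewrite sumr_const card_ord.
apply: ler_sum => a _; rewrite ler_pdivrMr ?mulr_gt0// mul1r.
have -> : (n_class z a)%:R - n%:R * par_pi t a =
    - n%:R * (par_pi t a - (n_class z a)%:R / n%:R) :> R by field; rewrite gt_eqF.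
rewrite exprMn sqrrN -[X in _ * X]real_normK ?num_real// expr2 -mulrA ler_pM2l//.
apply: le_trans (pK a).
apply: (@le_trans _ _ (n%:R * D ^+ 2)).
  by rewrite ler_pM2l// lerXn2r ?nnegrE// ?(ltW D0)//; exact: box_pi.
have K1 : 1 <= K%:R :> R by rewrite ler1n.
have -> : n%:R * D ^+ 2 = (2 * K%:R)^-1 * (2 * K%:R)^-1.
  by rewrite /D -rn2; field; rewrite !gt_eqF//; apply: lt_le_trans rn1.
rewrite ler_piMl ?(ltW iK)// invf_le1 ?mulr_gt0//; lra.
Qed.

(** The factors come from the chi-square cost of the classes, from the sides D / k multiplied by the
    root of n, and from the cells. Each cell pays exp(-25) / 3 by [beta_box] and a further 1/2 from
    [sq_le]. *)
Definition lower_const : R :=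
  expR (- k%:R) * (2 * K%:R * k%:R)^-1 ^+ k.-1 * (expR (- 25) / 6) ^+ size (P_coords k).

Lemma lower_const_gt0 : 0 < lower_const.
Proof.
by rewrite /lower_const !mulr_gt0 ?exprn_gt0 ?expR_gt0// ?divr_gt0 ?expR_gt0// invr_gt0 !mulr_gt0.
Qed.

Let sq p : R := Num.sqrt (n_present z x p + n_absent z x p).+2%:R.
Let dd p : R := beta_d R (n_present z x p) (n_absent z x p).
Let cl p : R := T0 p ^+ n_present z x p * (1 - T0 p) ^+ n_absent z x p.

Let sq_gt0 p : 0 < sq p. Proof. by rewrite sqrtr_gt0 ltr0n. Qed.
Let dd_gt0 p : 0 < dd p. Proof. exact: beta_d_gt0. Qed.
Let cl_ge0 p : 0 <= cl p.
Proof. by have /andP[a b] := T01 p; rewrite mulr_ge0 ?exprn_ge0 ?subr_ge0. Qed.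

Let sq_le p : sq p <= 2 * n%:R.
Proof.
rewrite -[leRHS]ger0_norm ?mulr_ge0 ?(ltW n0)// -sqrtr_sqr ler_wsqrtr//.
rewrite -natrM -natrX ler_nat.
apply: (@leq_trans (n * n).+2); first by rewrite !ltnS n_cell_le.
by move: hn; case: (n) => // m _; rewrite expnS expn1; nia.
Qed.

Let clV_ge0 p : 0 <= cl p * (expR (- 25) / 3) / (dd p * sq p).
Proof.
have := sq_gt0 p; have := dd_gt0 p => ? ?.
by rewrite divr_ge0// mulr_ge0 ?cl_ge0 ?divr_ge0 ?expR_ge0// ltW.
Qed.

(** Each free class probability costs one factor [rn], the inverse order of its side. Each edge
    parameter costs [rn] squared: its box has prior mass of order 1 / sqrt(m + 2) for m edges in the
    cell, and m <= n^2. *)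
Lemma joint_lower :
  \prod_i pi0 (z i) * edge_lik T0 z x * lower_const <=
  rn ^+ (k.-1 + k * k.+1) * prior_int (fun t : par_idx k -> R =>
     sbm_joint (par_pi t) (par_P t) z x * prior_dens t).
Proof.
(* A lower bound for the integrand on the box. The side [dd p] in the denominator cancels against
   the volume of the box. *)
pose V := (\prod_i pi0 (z i) * expR (- k%:R)) *
  \prod_(p : 'I_k * 'I_k | (p.1 <= p.2)%N) (cl p * (expR (- 25) / 3) / (dd p * sq p)).
have pz0 : 0 <= \prod_i pi0 (z i) by apply: prodr_ge0.
have V0 : 0 <= V.
  rewrite /V !mulr_ge0 ?expR_ge0//; apply: prodr_ge0 => p _; exact: clV_ge0.
have hV t : in_cube t -> (forall i, i \in par_coords k -> box_l i <= t i <= box_r i) ->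
    V <= sbm_joint (par_pi t) (par_P t) z x * prior_dens t.
  move=> ct tb; have st := box_simplex tb.
  have iK : 0 < (2 * K%:R)^-1 :> R by rewrite invr_gt0 mulr_gt0.
  rewrite (@sbm_jointE _ _ _ _ _ (fun p => t (inr p))); last by move=> a b; exact: par_PE.
  rewrite prior_cubeE// edge_lik_ocells big_P_coords.
  set A := \prod_i par_pi t (z i); set B := \prod_(i | _) _.
  set G := isqrt_pos (1 - _); set H := \prod_(i <- _) _; set J := \prod_(p | _) _.
  have -> : A * B * (H * G * J) = (A * (H * G)) * (B * J) by ring.
  apply: ler_pM.
  - by rewrite mulr_ge0// expR_ge0.
  - by apply: prodr_ge0 => p _; exact: clV_ge0.
  - apply: le_trans (box_class tb) _; rewrite ler_peMr//.
      by apply: prodr_ge0 => i _; apply: le_trans (box_pi_lower _ tb); exact: ltW.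
    rewrite /H /G -(prod_par_pi hk (@isqrt_pos R)).
    elim/big_rec : _ => // a y _ y1; rewrite -[leLHS]mulr1; apply: ler_pM => //.
    apply: isqrt_pos_ge1; rewrite (lt_le_trans iK (box_pi_lower _ tb))/=.
    rewrite -(sum_par_pi hk t) (bigD1 a)//= lerDl sumr_ge0// => b _.
    by apply: le_trans (box_pi_lower _ tb); exact: ltW.
  - rewrite /B /J -big_split/=; apply: ler_prod => p pp.
    rewrite clV_ge0/=.
    have /= tp := tb (inr p); rewrite mem_par_coords_inr pp in tp.
    have h := @beta_box R _ _ (t (inr p)) (T0 p) (tp isT) (T01 p).
    rewrite ler_pdivrMr; last exact: mulr_gt0.
    rewrite [leRHS]mulrC /cl /dd /sq; exact h.
have := prior_int_box hk (dominated_joint R hk z x) V0 box_itv hV.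
set E := prior_int _ => hE.
apply: le_trans (_ : rn ^+ (k.-1 + k * k.+1) * (V * ((\prod_(i <- pi_coords k) (box_r i - box_l i)) *
        \prod_(i <- P_coords k) (box_r i - box_l i))) <= _); last first.
  by rewrite ler_wpM2l// exprn_ge0// (le_trans _ rn1).
rewrite big_pi_coords big_P_coords/=.
rewrite [X in V * (X * _)](_ : _ = (D / k%:R) ^+ k.-1); last first.
  rewrite (eq_bigr (fun=> D / k%:R)); last by move=> a _; rewrite addrC addKr.
  rewrite -(big_pi_coords (@GRing.mul R) (fun=> D / k%:R)).
  by rewrite big_const_seq count_predT iter_mulr_1 size_pi_coords.
rewrite [X in V * (_ * X)](_ : _ = \prod_(p : 'I_k * 'I_k | (p.1 <= p.2)%N) dd p); last first.
  by apply: eq_bigr => p _; rewrite addrC addKr.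
rewrite edge_lik_ocells -/cl.
have -> : rn ^+ (k.-1 + k * k.+1) * (V * ((D / k%:R) ^+ k.-1 *
    \prod_(p : 'I_k * 'I_k | (p.1 <= p.2)%N) dd p)) =
  (\prod_i pi0 (z i) * expR (- k%:R)) * (rn * (D / k%:R)) ^+ k.-1 *
  (rn ^+ (k * k.+1) * \prod_(p : 'I_k * 'I_k | (p.1 <= p.2)%N) (cl p * (expR (- 25) / 3) / sq p)).
  rewrite /V (exprMn _ rn) exprD.
  have -> : \prod_(p : 'I_k * 'I_k | (p.1 <= p.2)%N) (cl p * (expR (- 25) / 3) / sq p) =
     \prod_(p : 'I_k * 'I_k | (p.1 <= p.2)%N) (cl p * (expR (- 25) / 3) / (dd p * sq p)) *
     \prod_(p : 'I_k * 'I_k | (p.1 <= p.2)%N) dd p.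
    by rewrite -big_split/=; apply: eq_bigr => p _; field; rewrite !gt_eqF.
  set W1 := \prod_(p | _) (_ / (dd p * _)); set W2 := \prod_(p | _) dd p.
  by ring.
have -> : rn * (D / k%:R) = (2 * K%:R * k%:R)^-1.
  by rewrite /D; field; rewrite !gt_eqF//; apply: lt_le_trans rn1.
rewrite -size_P_coords exprM expr2 rn2.
have -> : n%:R ^+ size (P_coords k) = \prod_(p : 'I_k * 'I_k | (p.1 <= p.2)%N) n%:R :> R.
  rewrite -(big_P_coords (@GRing.mul R) (fun=> n%:R)).
  by rewrite big_const_seq count_predT iter_mulr_1.
rewrite /lower_const -big_split/=.
have -> : (expR (- 25) / 6) ^+ size (P_coords k) =
    \prod_(p : 'I_k * 'I_k | (p.1 <= p.2)%N) (expR (- 25) / 6) :> R.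
  rewrite -(big_P_coords (@GRing.mul R) (fun=> expR (- 25) / 6)).
  by rewrite big_const_seq count_predT iter_mulr_1.
set u := _ ^+ k.-1.
rewrite [leLHS](_ : _ = \prod_i pi0 (z i) * expR (- k%:R) * u *
   ((\prod_(p : 'I_k * 'I_k | (p.1 <= p.2)%N) cl p) *
    (\prod_(p : 'I_k * 'I_k | (p.1 <= p.2)%N) (expR (- 25) / 6)))); last by ring.
apply: ler_wpM2l.
  by rewrite !mulr_ge0 ?expR_ge0// /u exprn_ge0// invr_ge0 !mulr_ge0// ltW.
rewrite -big_split/=; apply: ler_prod => p _.
rewrite mulr_ge0 ?cl_ge0 ?divr_ge0 ?expR_ge0//=.
have h : 6^-1 <= n%:R / (3 * sq p).
  have s0 := sq_gt0 p; rewrite ler_pdivlMr ?mulr_gt0//.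
  by have := sq_le p; lra.
rewrite [leRHS](_ : _ = cl p * (expR (- 25) * (n%:R / (3 * sq p)))); last first.
  by field; rewrite gt_eqF.
apply: ler_wpM2l; first exact: cl_ge0.
by apply: ler_wpM2l; first exact: expR_ge0.
Qed.

End Lower.

(** * The mixture as a distribution on networks *)

Section KTprop.
Variables (R : realType) (k : nat).
Hypothesis hk : (0 < k)%N.

Definition joint_prior n (z : 'I_n -> 'I_k) (x : network n) (t : par_idx k -> R) : R :=
  sbm_joint (par_pi t) (par_P t) z x * prior_dens t.

Definition prior_mass : R := prior_int (@prior_dens R k).

(** A fixed box suffices: free class probabilities between 1 / (2 k) and 1 / k leave at least 1 / k
    for the last one, and edge parameters in [1/4, 1/2] give every edge a factor at least 1/4.
    Positivity gives meaning to the logarithm in [KT_crit]. *)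
Lemma joint_prior_int_gt0 n (z : 'I_n -> 'I_k) (x : network n) :
  0 < prior_int (joint_prior z x).
Proof.
pose l (i : par_idx k) : R := if i is inl _ then (2 * k%:R)^-1 else 4^-1.
pose r (i : par_idx k) : R := if i is inl _ then k%:R^-1 else 2^-1.
have k0 : 0 < k%:R :> R by rewrite ltr0n.
have k1 : 1 <= k%:R :> R by rewrite ler1n.
have kV : (2 * k%:R)^-1 = k%:R^-1 / 2 :> R by field; rewrite gt_eqF.
have kV0 : 0 < k%:R^-1 :> R by rewrite invr_gt0.
have kV1 : k%:R^-1 <= 1 :> R by rewrite invf_le1.
have lr i : [&& 0 <= l i, l i < r i & r i <= 1].
  by case: i => [a|p]; rewrite /l /r ?kV; apply/and3P; split; lra.
pose V : R := (2 * k%:R)^-1 ^+ n * \prod_(e : 'I_n * 'I_n | (e.1 < e.2)%N) 4^-1.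
have V0 : 0 < V.
  by rewrite mulr_gt0 ?exprn_gt0 ?invr_gt0 ?mulr_gt0// prodr_gt0// => *; rewrite invr_gt0.
have hV t : in_cube t -> (forall i, i \in par_coords k -> l i <= t i <= r i) ->
    V <= joint_prior z x t.
  move=> ct tb.
  have pl a : (2 * k%:R)^-1 <= par_pi t a.
    rewrite /par_pi; case: ifPn => ak.
      by have := tb (inl a); rewrite mem_par_coords_inl => /(_ ak) /andP[].
    have : \sum_(b < k | (b < k.-1)%N) t (inl b) <= \sum_(b < k | (b < k.-1)%N) k%:R^-1.
      by apply: ler_sum => b bk; have := tb (inl b); rewrite mem_par_coords_inl => /(_ bk) /andP[].
    have : \sum_(b < k) k%:R^-1 = 1 :> R.
      by rewrite sumr_const card_ord -[LHS]mulr_natr mulVf// gt_eqF.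
    rewrite (bigID (fun b : 'I_k => (b < k.-1)%N))/= => e1 h.
    have : k%:R^-1 <= \sum_(b < k | ~~ (b < k.-1)%N) k%:R^-1 :> R.
      by rewrite (bigD1 a)//= lerDl; apply: sumr_ge0 => *; exact: ltW.
    by rewrite kV; lra.
  have pp a : 0 < par_pi t a by apply: lt_le_trans (pl a); rewrite invr_gt0 mulr_gt0.
  have p1 a : par_pi t a <= 1.
    rewrite -(sum_par_pi hk t) (bigD1 a)//= lerDl; apply: sumr_ge0 => b _; exact: ltW.
  have ch (p : 'I_k * 'I_k) : (p.1 <= p.2)%N -> 4^-1 <= t (inr p) <= 2^-1.
    by move=> pp'; have := tb (inr p); rewrite mem_par_coords_inr => /(_ pp').
  rewrite /joint_prior (@sbm_jointE _ _ _ _ _ (fun p => t (inr p))); last by move=> a b; exact: par_PE.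
  have Vj : V <= \prod_i par_pi t (z i) * edge_lik (fun p => t (inr p)) z x.
    apply: ler_pM.
    - by rewrite exprn_ge0// invr_ge0 mulr_ge0// ltW.
    - by apply: prodr_ge0 => *; rewrite invr_ge0.
    - rewrite -[n in _ ^+ n]card_ord -prodr_const; apply: ler_prod => i _.
      by rewrite invr_ge0 mulr_ge0 ?(ltW k0)//= pl.
    - apply: ler_prod => e _; rewrite invr_ge0 ler0n/=.
      have /andP[h1 h2] := ch (edge_cell z e) (cell_le _ _).
      by case: ifP => _; lra.
  apply: le_trans Vj _; rewrite ler_peMr//.
    rewrite mulr_ge0//; first by apply: prodr_ge0 => i _; exact: ltW.
    by apply: edge_lik_ge0 => p; exact: ct.
  rewrite prior_cubeE// -(prod_par_pi hk (@isqrt_pos R)) big_P_coords.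
  rewrite -[leLHS]mulr1; apply: ler_pM => //.
  - elim/big_rec : _ => // a y _ y1; rewrite -[leLHS]mulr1; apply: ler_pM => //.
    by apply: isqrt_pos_ge1; rewrite pp p1.
  - elim/big_rec : _ => // p y pp' y1; rewrite -[leLHS]mulr1; apply: ler_pM => //.
    have /andP[h1 h2] := ch p pp'.
    rewrite -[leLHS]mulr1; apply: ler_pM => //; apply: isqrt_pos_ge1; apply/andP; split; lra.
apply: lt_le_trans (prior_int_box hk (dominated_joint R hk z x) (ltW V0) (l := l) (r := r) _ hV).
- rewrite mulr_gt0// mulr_gt0//; apply: prodr_gt0 => i _;
  by have /and3P[_ h _] := lr i; rewrite subr_gt0.
- by move=> i _; have /and3P[-> /ltW -> ->] := lr i.
Qed.

Lemma joint_prior_le n (z : 'I_n -> 'I_k) (x : network n) t :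
  in_cube t -> joint_prior z x t <= prior_dens t.
Proof.
move=> ct; rewrite /joint_prior; have [st|st] := boolP (in_simplex t); last by rewrite prior_out// mulr0.
by have /andP[_ h] := cube_joint_itv hk z x ct st; rewrite ler_piMl// prior_ge0.
Qed.

Lemma prior_mass_gt0 : 0 < prior_mass.
Proof.
(* With no nodes the joint likelihood is an empty product, so positivity of the prior mass is an
   instance of the previous positivity. *)
pose z : 'I_0 -> 'I_k := fun=> Ordinal hk.
pose x : network 0 := fun _ _ => false.
apply: lt_le_trans (joint_prior_int_gt0 z x) _.
apply: prior_int_le => //; [exact: dominated_joint|exact: dominated_prior|].
by move=> t ct; exact: joint_prior_le.
Qed.

Lemma KTE n (x : network n) :
  KT R k x = (\sum_(z : {ffun 'I_n -> 'I_k}) prior_int (joint_prior z x)) / prior_mass.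
Proof.
rewrite -prior_int_sum//; last by move=> z; exact: dominated_joint.
rewrite /KT; congr (fine (int_Theta _) / _).
by apply/funext => t; rewrite /sbm_lik mulr_suml.
Qed.

Lemma KT_gt0 n (x : network n) : 0 < KT R k x.
Proof.
rewrite KTE divr_gt0 ?prior_mass_gt0//.
rewrite (bigD1 [ffun=> Ordinal hk])//= ltr_wpDr ?joint_prior_int_gt0//.
by apply: sumr_ge0 => z _; apply: ltW; exact: joint_prior_int_gt0.
Qed.

Lemma lik_prior_int n (x : network n) :
  dominated (fun t : par_idx k -> R => sbm_lik (par_pi t) (par_P t) x * prior_dens t) /\
  prior_int (fun t : par_idx k -> R => sbm_lik (par_pi t) (par_P t) x * prior_dens t) =
  KT R k x * prior_mass.
Proof.
split; last by rewrite /KT divfK// gt_eqF// prior_mass_gt0.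
rewrite (_ : (fun t => _) = (fun t => \sum_(z : {ffun 'I_n -> 'I_k}) joint_prior z x t)).
  by apply: dominated_sum => z; exact: dominated_joint.
by apply/funext => t; rewrite /sbm_lik mulr_suml.
Qed.

(** The mixture is an average over parameters, so a uniform bound survives. Taken over all networks
    this says that [KT] has total mass at most 1; taken over one network it bounds [KT] by the
    largest likelihood. *)
Lemma sum_KT_le (J : Type) (s : seq J) (Q : pred J) n (x : J -> network n) (B : R) :
  0 <= B ->
  (forall t : par_idx k -> R, in_cube t -> in_simplex t ->
    \sum_(j <- s | Q j) sbm_lik (par_pi t) (par_P t) (x j) <= B) ->
  \sum_(j <- s | Q j) KT R k (x j) <= B.
Proof.
move=> B0 h.
rewrite -(@ler_pM2r _ prior_mass) ?prior_mass_gt0// mulr_suml.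
rewrite (eq_bigr _ (fun j _ => esym (lik_prior_int (x j)).2)) -prior_int_sum//; last first.
  by move=> j; exact: (lik_prior_int (x j)).1.
rewrite -prior_intZ//; last exact: dominated_prior.
apply: prior_int_le => //.
- by apply: dominated_sum => j; exact: (lik_prior_int (x j)).1.
- by apply: dominatedZ => //; exact: dominated_prior.
move=> t ct; rewrite -mulr_suml.
have [st|st] := boolP (in_simplex t); last by rewrite prior_out// !mulr0.
by rewrite ler_wpM2r ?prior_ge0// h.
Qed.

Lemma KT_le n (x : network n) (B : R) : 0 <= B ->
  (forall t : par_idx k -> R, in_cube t -> in_simplex t -> sbm_lik (par_pi t) (par_P t) x <= B) ->
  KT R k x <= B.
Proof.
move=> B0 h; have := @sum_KT_le unit [:: tt] xpredT n (fun=> x) B B0.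
by rewrite big_seq1; apply => t ct st; rewrite big_seq1 h.
Qed.

End KTprop.

(** * Summation over networks and Hellinger affinity *)

Section Networks.
Variables (R : realType) (n : nat).

Local Notation Y := {ffun 'I_n * 'I_n -> bool}.

Definition sym_net (y : Y) : network n := fun i j =>
  if (i < j)%N then y (i, j) else if (j < i)%N then y (j, i) else false.

(** Arrays that are false off the strict upper triangle: each symmetric irreflexive network is
    [sym_net] of exactly one of them. In this [pfamily] form, sums of products over edges
    factorize. *)
Definition upper : {pred Y} :=
  pfamily false [pred e : 'I_n * 'I_n | (e.1 < e.2)%N] (fun=> predT).

Lemma sum_upper (F : 'I_n * 'I_n -> bool -> R) :
  \sum_(y in upper) \prod_(e : 'I_n * 'I_n | (e.1 < e.2)%N) F e (sym_net y e.1 e.2) =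
  \prod_(e : 'I_n * 'I_n | (e.1 < e.2)%N) (F e true + F e false).
Proof.
rewrite (eq_bigr (fun e => \sum_(b : bool | predT b) F e b)); last first.
  by move=> e _; rewrite big_bool.
rewrite (big_distr_big_dep false) /=; apply: eq_bigr => y _.
by apply: eq_bigr => -[i j] /= ij; rewrite /sym_net ij.
Qed.

Lemma sum_edge_lik k (T : 'I_k * 'I_k -> R) z :
  \sum_(y in upper) edge_lik T z (sym_net y) = 1.
Proof.
rewrite /edge_lik (sum_upper (fun e b => if b then T (edge_cell z e) else 1 - T (edge_cell z e))).
by apply: big1 => e _; rewrite addrC subrK.
Qed.

Lemma sum_labels k (pi : 'I_k -> R) : \sum_a pi a = 1 ->
  \sum_(z : {ffun 'I_n -> 'I_k}) \prod_i pi (z i) = 1.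
Proof.
move=> pi1; rewrite -(bigA_distr_bigA (fun (i : 'I_n) a => pi a)).
by apply: big1.
Qed.

Lemma sum_lik k (pi : 'I_k -> R) P : \sum_a pi a = 1 -> (forall a b, P a b = P b a) ->
  \sum_(y in upper) sbm_lik pi P (sym_net y) = 1.
Proof.
move=> pi1 sP; rewrite /sbm_lik exchange_big/= -[RHS](sum_labels pi1).
apply: eq_bigr => z _.
rewrite (eq_bigr (fun y => (\prod_i pi (z i)) * edge_lik (fun p => P p.1 p.2) z (sym_net y))).
  by rewrite -mulr_sumr sum_edge_lik mulr1.
by move=> y _; apply: sbm_jointE => a b; rewrite /cell; case: ifP.
Qed.

Lemma sum_KT_upper k : (0 < k)%N -> \sum_(y in upper) KT R k (sym_net y) <= 1.
Proof.
move=> hk; apply: sum_KT_le => // t ct st; rewrite sum_lik//.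
- exact: sum_par_pi.
- by move=> a b; rewrite !par_PE cellC.
Qed.

(** The affinity is 1 minus half the squared Hellinger distance. Dropping the distance between the
    roots of 1 - p and 1 - q and using 1 + x <= exp x leaves the stated bound. *)
Lemma affinity_le (p q : R) : 0 <= p <= 1 -> 0 <= q <= 1 ->
  Num.sqrt (p * q) + Num.sqrt ((1 - p) * (1 - q)) <=
  expR (- (Num.sqrt p - Num.sqrt q) ^+ 2 / 2).
Proof.
move=> /andP[p0 p1] /andP[q0 q1].
have p'0 : 0 <= 1 - p by lra.
have q'0 : 0 <= 1 - q by lra.
rewrite !sqrtrM//.
apply: le_trans (expR_ge1Dx _).
have h1 := sqr_ge0 (Num.sqrt (1 - p) - Num.sqrt (1 - q)).
have e (x : R) : 0 <= x -> Num.sqrt x * Num.sqrt x = x by move=> x0; rewrite -expr2 sqr_sqrtr.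
move: h1; rewrite !expr2 => h1.
have := e p p0; have := e q q0; have := e _ p'0; have := e _ q'0; lra.
Qed.

Lemma sqrtr_prod (I : Type) (r : seq I) (P : pred I) (F : I -> R) :
  (forall i, 0 <= F i) ->
  Num.sqrt (\prod_(i <- r | P i) F i) = \prod_(i <- r | P i) Num.sqrt (F i).
Proof.
move=> F0; elim: r => [|i r IH]; first by rewrite !big_nil sqrtr1.
by rewrite !big_cons; case: ifP => _ //; rewrite sqrtrM// IH.
Qed.

Lemma sqrtr_sum_le (I : Type) (r : seq I) (P : pred I) (F : I -> R) :
  (forall i, 0 <= F i) ->
  Num.sqrt (\sum_(i <- r | P i) F i) <= \sum_(i <- r | P i) Num.sqrt (F i).
Proof.
move=> F0; elim: r => [|i r IH]; first by rewrite !big_nil sqrtr0.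
rewrite !big_cons; case: ifP => _ //; apply: le_trans (lerD (lexx _) IH).
set S := \sum_(j <- r | P j) F j; have S0 : 0 <= S by exact: sumr_ge0.
rewrite -[leRHS]ger0_norm ?addr_ge0 ?sqrtr_ge0// -sqrtr_sqr ler_wsqrtr//.
rewrite sqrrD !sqr_sqrtr// addrAC lerDl.
by rewrite mulrn_wge0// mulr_ge0 ?sqrtr_ge0.
Qed.

Lemma sum_sqrt_lik k k' (T : 'I_k * 'I_k -> R) (T' : 'I_k' * 'I_k' -> R) z z' :
  (forall p, 0 <= T p <= 1) -> (forall p, 0 <= T' p <= 1) ->
  \sum_(y in upper) Num.sqrt (edge_lik T z (sym_net y) * edge_lik T' z' (sym_net y)) <=
  expR (- (\sum_(e : 'I_n * 'I_n | (e.1 < e.2)%N)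
      (Num.sqrt (T (edge_cell z e)) - Num.sqrt (T' (edge_cell z' e))) ^+ 2) / 2).
Proof.
move=> hT hT'.
pose F (e : 'I_n * 'I_n) (b : bool) : R :=
  Num.sqrt ((if b then T (edge_cell z e) else 1 - T (edge_cell z e)) *
            (if b then T' (edge_cell z' e) else 1 - T' (edge_cell z' e))).
rewrite (eq_bigr (fun y => \prod_(e : 'I_n * 'I_n | (e.1 < e.2)%N) F e (sym_net y e.1 e.2))); last first.
  move=> y _; rewrite /edge_lik -big_split/= sqrtr_prod//.
  move=> e; have /andP[h1 h2] := hT (edge_cell z e); have /andP[h3 h4] := hT' (edge_cell z' e).
  by case: (sym_net y _ _); rewrite mulr_ge0// subr_ge0.
rewrite sum_upper -sumrN mulr_suml expR_sum.
apply: ler_prod => e _; rewrite addr_ge0 ?sqrtr_ge0//=.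
exact: affinity_le.
Qed.

End Networks.

(** * Maximum likelihood edge parameters *)

Section Grid.
Variables (R : realType) (n k : nat).

(** Possible numbers of present and absent edges in each cell. Every cellwise maximum likelihood
    estimate, for any labelling and network, is a [grid_par], and there are only polynomially many
    of these in n. *)
Definition grid := {ffun 'I_k * 'I_k -> 'I_(n * n).+1 * 'I_(n * n).+1}.

Definition grid_par (g : grid) (p : 'I_k * 'I_k) : R :=
  (g p).1%:R / ((g p).1 + (g p).2)%:R.

Lemma grid_par_itv g p : 0 <= grid_par g p <= 1.
Proof.
rewrite /grid_par divr_ge0//=.
case: (posnP ((g p).1 + (g p).2)) => [->|h]; first by rewrite invr0 mulr0.
by rewrite ler_pdivrMr ?ltr0n// mul1r ler_nat leq_addr.
Qed.

(** At the empirical frequency the chi-square term of [gibbs_bernoulli] vanishes. When o or j is 0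
    this frequency is not interior, but the right-hand side is either 1 or, for j = 0 < o, again 1;
    for o = 0 it reduces to 1 by the convention 0 / x = 0. *)
Lemma bernoulli_mle (o j : nat) (t : R) : 0 <= t <= 1 ->
  t ^+ o * (1 - t) ^+ j <=
  (o%:R / (o + j)%:R) ^+ o * (1 - o%:R / (o + j)%:R) ^+ j.
Proof.
move=> ti; have /andP[t0 t1] := ti.
have le1 : t ^+ o * (1 - t) ^+ j <= 1.
  by rewrite mulr_ile1 ?exprn_ge0 ?exprn_ile1 ?subr_ge0// gerBl.
case: o le1 => [|o] le1; first by rewrite mul0r subr0 expr0 expr1n mulr1.
case: j le1 => [|j] le1.
  by apply: le_trans le1 _; rewrite addn0 divff ?pnatr_eq0// expr1n subrr expr0 mulr1.
have m0 : 0 < (o.+1 + j.+1)%:R :> R by rewrite ltr0n.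
have := @gibbs_bernoulli R o.+1 j.+1 t (o.+1%:R / (o.+1 + j.+1)%:R) isT ti.
rewrite divr_gt0 ?ltr0n//= ltr_pdivrMr// mul1r ltr_nat -[X in (X < _)%N]addn0 ltn_add2l.
move=> /(_ isT); rewrite [X in X ^+ 2](_ : _ = 0); last by field; rewrite gt_eqF.
by rewrite expr0n/= mul0r expR0 mulr1.
Qed.

Lemma edge_lik_grid (T : 'I_k * 'I_k -> R) (z : 'I_n -> 'I_k) x :
  (forall p, 0 <= T p <= 1) ->
  edge_lik T z x <= \sum_(g : grid) edge_lik (grid_par g) z x.
Proof.
move=> hT.
pose g : grid := [ffun p => (inord (n_present z x p), inord (n_absent z x p))].
have lo p : (n_present z x p < (n * n).+1)%N.
  by rewrite ltnS (leq_trans _ (n_cell_le z x p))// leq_addr.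
have lj p : (n_absent z x p < (n * n).+1)%N.
  by rewrite ltnS (leq_trans _ (n_cell_le z x p))// leq_addl.
rewrite (bigD1 g)//= -[leLHS]addr0; apply: lerD; last first.
  by apply: sumr_ge0 => h _; apply: edge_lik_ge0 => p; exact: grid_par_itv.
rewrite !edge_lik_cells; apply: ler_prod => p _.
have /andP[h0 h1] := hT p.
rewrite mulr_ge0 ?exprn_ge0 ?subr_ge0//= /grid_par ffunE/= !inordK//.
exact: bernoulli_mle.
Qed.

(** A maximum likelihood estimate depends on x; summing over the whole grid gives a family
    independent of x, so that the sum over networks can later be moved inside. *)
Lemma KT_le_grid (hk : (0 < k)%N) (x : network n) :
  KT R k x <= \sum_(z : {ffun 'I_n -> 'I_k}) \sum_(g : grid) edge_lik (grid_par g) z x.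
Proof.
apply: KT_le => //.
  apply: sumr_ge0 => z _; apply: sumr_ge0 => g _.
  by apply: edge_lik_ge0 => p; exact: grid_par_itv.
move=> t ct st; rewrite /sbm_lik; apply: ler_sum => z _.
rewrite (@sbm_jointE _ _ _ _ _ (fun p => t (inr p))); last by move=> a b; exact: par_PE.
apply: le_trans (@edge_lik_grid (fun p => t (inr p)) z x (fun p => ct (inr p))).
rewrite ler_piMl//; first by apply: edge_lik_ge0 => p; exact: ct.
apply: prod_le1 => i _; rewrite par_pi_ge0//=.
rewrite -(sum_par_pi hk t) (bigD1 (z i))//= lerDl; apply: sumr_ge0 => b _.
exact: par_pi_ge0.
Qed.

Lemma card_grid : #|{: grid}| = (((n * n).+1 * (n * n).+1) ^ (k * k))%N.
Proof. by rewrite card_ffun !card_prod !card_ord. Qed.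

End Grid.

(** * Separation and typical labellings *)

Lemma finite_pos_lower_bound (R : realType) (I : finType) (P : pred I) (F : I -> R) :
  (forall i, P i -> 0 < F i) -> exists2 c, 0 < c & forall i, P i -> c <= F i.
Proof.
move=> F0.
have S0 : 0 <= \sum_(i | P i) (F i)^-1 by apply: sumr_ge0 => i /F0 h; rewrite invr_ge0 ltW.
exists (1 + \sum_(i | P i) (F i)^-1)^-1; first by rewrite invr_gt0 ltr_wpDr.
move=> i Pi; have Fi := F0 i Pi.
rewrite -[leRHS]invrK lef_pV2 ?posrE ?invr_gt0 ?ltr_wpDr//.
rewrite (bigD1 i)//= addrCA lerDl addr_ge0//.
by apply: sumr_ge0 => j /andP[/F0 h _]; rewrite invr_ge0 ltW.
Qed.

Definition typical n k K (z : 'I_n -> 'I_k) :=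
  [forall a, n <= K * n_class z a]%N.

Section Separation.
Variables (R : realType) (n k0 k K : nat).
Hypotheses (hk : (0 < k)%N) (hK : (0 < K)%N).
Variables (z : 'I_n -> 'I_k0) (z' : 'I_n -> 'I_k).

Definition n_both a u := #|[pred i | (z i == a) && (z' i == u)]|.

Lemma exists_frequent a : (n <= K * n_class z a)%N ->
  exists u, (n <= K * k * n_both a u)%N.
Proof.
move=> typ; apply/existsP; rewrite -[X in is_true X]negbK negb_exists.
apply/negP => /forallP h.
have e : n_class z a = (\sum_(u < k) n_both a u)%N.
  rewrite /n_class -sum1_card (partition_big z' xpredT)//=.
  by apply: eq_bigr => u _; rewrite sum1_card.
(* Strict inequality for each of the k labels gains k units in the sum, which contradicts the size
   of the class because k > 0. *)
have h1 : (\sum_(u < k) (K * k * n_both a u).+1 <= \sum_(u < k) n)%N.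
  by apply: leq_sum => u _; rewrite ltnNge; exact: h.
have h2 : (\sum_(u < k) (K * k * n_both a u).+1 = K * k * n_class z a + k)%N.
  rewrite e big_distrr/= -[X in (_ + X)%N]card_ord -sum1_card -big_split/=.
  by apply: eq_bigr => u _; rewrite addn1.
rewrite h2 sum_nat_const card_ord in h1.
have : (k * n <= k * (K * n_class z a))%N by rewrite leq_mul2l typ orbT.
by nia.
Qed.

Lemma sum_sym_pairs (g : 'I_n -> 'I_n -> R) : (forall i j, g i j = g j i) ->
  \sum_i \sum_(j | j != i) g i j =
  2 * \sum_(e : 'I_n * 'I_n | (e.1 < e.2)%N) g e.1 e.2.
Proof.
move=> sg; rewrite pair_big_dep/=.
rewrite (bigID (fun e : 'I_n * 'I_n => (e.1 < e.2)%N))/= mulr_natl mulr2n; congr (_ + _).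
  apply: eq_bigl => -[i j] /=; rewrite -val_eqE/=; lia.
rewrite (reindex_inj (h := fun e : 'I_n * 'I_n => (e.2, e.1))); last by move=> [? ?] [? ?] [-> ->].
rewrite /=; apply: eq_big => [[i j]|[i j] _] /=; last exact: sg.
by rewrite -val_eqE/=; lia.
Qed.

Lemma card_minus_one (A : pred 'I_n) i :
  (#|A|%:R - 1 : R) <= \sum_(j | j != i) (A j)%:R.
Proof.
have -> : #|A|%:R = \sum_j (A j)%:R :> R.
  by rewrite -sum1_card natr_sum big_mkcond/=; apply: eq_bigr => j _; rewrite unfold_in; case: (A j).
rewrite (bigD1 i)//=; case: (A i) => /=; lra.
Qed.

Variables (S : 'I_k0 -> 'I_k0 -> R) (rho gamma : R) (T' : 'I_k * 'I_k -> R).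
Hypotheses (sS : forall a b, S a b = S b a) (rho0 : 0 < rho) (gamma0 : 0 < gamma).
Hypothesis sep : forall a b, a != b ->
  exists c, gamma <= (Num.sqrt (S c a) - Num.sqrt (S c b)) ^+ 2.
Hypothesis typ : typical K z.
Hypothesis kk0 : (k < k0)%N.
Hypothesis n_large : (2 * (K * k) <= n)%N.

(** Two true classes a and b have the same dominant label. Edges joining their dominant parts to
    that of c share one fitted root w, which cannot be close to both true roots: (al - w)^2 + (be -
    w)^2 >= (al - be)^2 / 2 >= rho gamma / 2. There are of order L^2 such pairs, where L = n / (K
    k). The argument allows c to be a or b. *)
Lemma separation :
  gamma / (8 * (K * k)%:R ^+ 2) * (rho * n%:R ^+ 2) <=
  \sum_(e : 'I_n * 'I_n | (e.1 < e.2)%N)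
    (Num.sqrt (rho * S (edge_cell z e).1 (edge_cell z e).2)
     - Num.sqrt (T' (edge_cell z' e))) ^+ 2.
Proof.
have [phi hphi] := choice (fun a => exists_frequent (forallP typ a)).
have /injectivePn[a [b ab phiab]] : ~~ injectiveb phi.
  apply/injectiveP => /leq_card; by rewrite !card_ord leqNgt kk0.
have [c hc] := sep ab.
pose g i j : R := (Num.sqrt (rho * S (cell (z i) (z j)).1 (cell (z i) (z j)).2)
     - Num.sqrt (T' (cell (z' i) (z' j)))) ^+ 2.
have gs i j : g i j = g j i by rewrite /g cellC (cellC (z' i)).
have Scell x y : S (cell x y).1 (cell x y).2 = S x y by rewrite /cell; case: ifP.
have g0 i j : 0 <= g i j by exact: sqr_ge0.
pose A := [pred i | (z i == a) && (z' i == phi a)].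
pose B := [pred i | (z i == b) && (z' i == phi b)].
pose C := [pred i | (z i == c) && (z' i == phi c)].
pose al := Num.sqrt (rho * S c a). pose be := Num.sqrt (rho * S c b).
pose w := Num.sqrt (T' (cell (phi c) (phi a))).
pose M : R := (K * k)%:R.
have M0 : 0 < M by rewrite ltr0n muln_gt0 hK.
pose L : R := n%:R / M.
have cardL d : L <= (n_both d (phi d))%:R.
  by rewrite /L ler_pdivrMr// mulrC -natrM ler_nat.
(* Makes L - 1 at least L / 2, which absorbs the excluded pair j = i. *)
have L2 : 2 <= L by rewrite /L ler_pdivlMr// -natrM ler_nat.
have key i : C i -> L / 2 * (rho * gamma / 2) <= \sum_(j | j != i) g i j.
  move=> /andP[/eqP zi /eqP z'i].
  apply: (@le_trans _ _ (\sum_(j | j != i) ((A j)%:R * (al - w) ^+ 2 + (B j)%:R * (be - w) ^+ 2))).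
    rewrite big_split/= -!mulr_suml.
    have hA : L - 1 <= \sum_(j | j != i) (A j)%:R.
      by apply: le_trans (card_minus_one A i); rewrite lerD2r; exact: cardL.
    have hB : L - 1 <= \sum_(j | j != i) (B j)%:R.
      by apply: le_trans (card_minus_one B i); rewrite lerD2r; exact: cardL.
    have p1 := sqr_ge0 (al - w); have p2 := sqr_ge0 (be - w).
    have h1 := ler_wpM2r p1 hA; have h2 := ler_wpM2r p2 hB.
    apply: le_trans (lerD h1 h2); rewrite -mulrDr.
    apply: ler_pM; [by lra| by rewrite !mulr_ge0// ltW|by lra|].
    have albe : rho * gamma <= (al - be) ^+ 2.
      rewrite /al /be !sqrtrM ?(ltW rho0)// -mulrBr exprMn sqr_sqrtr ?(ltW rho0)//.
      by rewrite ler_pM2l.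
    have := sqr_ge0 (al - w + (be - w)); move: albe; rewrite !expr2; lra.
  apply: ler_sum => j _.
  have [Aj|Aj] := boolP (A j).
    have Bj : B j = false.
      by move: Aj => /andP[/eqP zj _]; rewrite /B/= zj (negbTE ab).
    move: Aj => /andP[/eqP zj /eqP z'j].
    by rewrite Bj mul1r mul0r addr0 /g Scell zi zj z'i z'j.
  have [Bj|Bj] := boolP (B j); last by rewrite !mul0r addr0.
  move: Bj => /andP[/eqP zj /eqP z'j].
  by rewrite mul0r add0r mul1r /g Scell zi zj z'i z'j -phiab.
have tot : L * (L / 2 * (rho * gamma / 2)) <= \sum_i \sum_(j | j != i) g i j.
  have h0 : 0 <= L / 2 * (rho * gamma / 2).
    by apply: mulr_ge0; [lra|rewrite divr_ge0// mulr_ge0// ltW].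
  apply: le_trans (ler_wpM2r h0 (cardL c)) _.
  rewrite (bigID C)/= -[leLHS]addr0; apply: lerD; last first.
    by apply: sumr_ge0 => i _; apply: sumr_ge0.
  rewrite mulr_natl -sumr_const; apply: ler_sum => i iC; exact: key.
rewrite sum_sym_pairs// in tot.
have LE : L * (L / 2 * (rho * gamma / 2)) = 2 * (gamma / (8 * M ^+ 2) * (rho * n%:R ^+ 2)).
  by rewrite /L; move: (M) M0 => m m0; field; rewrite gt_eqF.
rewrite LE in tot.
by rewrite -(@ler_pM2l _ 2)//.
Qed.

End Separation.

(** * Exponential rarity of small classes *)

Section Atypical.
Variables (R : realType) (k : nat) (pi : 'I_k -> R).
Hypotheses (pi_gt0 : forall a, 0 < pi a) (pi1 : \sum_a pi a = 1).

Lemma bernoulli_ineq (h : R) m : 0 <= h -> 1 + m%:R * h <= (1 + h) ^+ m.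
Proof.
move=> h0; elim: m => [|m IH]; first by rewrite mul0r addr0 expr0.
rewrite exprS; apply: (@le_trans _ _ ((1 + h) * (1 + m%:R * h))); last first.
  by rewrite ler_wpM2l// addr_ge0.
have : 0 <= m%:R * (h * h) by rewrite !mulr_ge0.
by rewrite -natr1; lra.
Qed.

(** Chernoff's method: a node has weight s, and s q if it lies in class a, with q = s^-K. The total
    weight is s^(n - K n_a), at least 1 on the event. With s = 1 + p / 2 the condition K p >= 6
    yields q <= 1/4, and the mean weight per node is at most (1 + p / 2) (1 - 3 p / 4) <= 1 - p /
    4. *)
Lemma atypical_class n K a : 6 <= K%:R * pi a ->
  \sum_(z : {ffun 'I_n -> 'I_k} | (K * n_class z a < n)%N) \prod_i pi (z i) <=
  (1 - pi a / 4) ^+ n.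
Proof.
move=> hK; set p := pi a.
have p0 : 0 < p by exact: pi_gt0.
have p1 : p <= 1.
  by rewrite -pi1 (bigD1 a)//= lerDl; apply: sumr_ge0 => b _; exact: ltW.
pose s : R := 1 + p / 2.
have s1 : 1 <= s by rewrite /s; lra.
have s0 : 0 < s by lra.
pose q := (s ^+ K)^-1.
have q0 : 0 < q by rewrite invr_gt0 exprn_gt0.
have q4 : q <= 4^-1.
  rewrite lef_pV2 ?posrE ?exprn_gt0//; apply: le_trans (bernoulli_ineq K _); last by lra.
  by rewrite mulrA; move: hK; rewrite -/p; lra.
pose h b := s * (if b == a then q else 1).
have hE (z : {ffun 'I_n -> 'I_k}) : \prod_i h (z i) = s ^+ n * q ^+ n_class z a.
  rewrite /h big_split/= prodr_const card_ord -big_mkcond/= prodr_const.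
  by [].
have h0 b : 0 <= h b by rewrite /h mulr_ge0 ?(ltW s0)//; case: ifP => // _; exact: ltW.
have pz0 (z : {ffun 'I_n -> 'I_k}) : 0 <= \prod_i pi (z i).
  by apply: prodr_ge0 => i _; exact: ltW.
apply: (@le_trans _ _ (\sum_(z : {ffun 'I_n -> 'I_k}) \prod_i (pi (z i) * h (z i)))).
  rewrite big_mkcond/=; apply: ler_sum => z _; rewrite big_split/=.
  case: ifPn => hz; last by rewrite mulr_ge0//; apply: prodr_ge0.
  rewrite ler_peMr// hE /q exprVn -exprM ler_pdivlMr ?exprn_gt0// mul1r.
  by rewrite ler_weXn2l// ltnW.
rewrite -(bigA_distr_bigA (fun (i : 'I_n) b => pi b * h b)) prodr_const card_ord.
apply: lerXn2r.
- by rewrite nnegrE; apply: sumr_ge0 => b _; rewrite mulr_ge0// ltW.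
- by rewrite nnegrE; lra.
have e : \sum_b pi b * h b = s * (1 - p + p * q).
  rewrite (bigD1 a)//= /h eqxx.
  rewrite (eq_bigr (fun b => s * pi b)); last by move=> b /negbTE ->; rewrite mulr1 mulrC.
  rewrite -mulr_sumr.
  have -> : \sum_(b | b != a) pi b = 1 - p by move: pi1; rewrite (bigD1 a)//= -/p; lra.
  by rewrite -/p; ring.
rewrite e; apply: (@le_trans _ _ (s * (1 - p + p * 4^-1))).
  by rewrite ler_pM2l// lerD2l ler_pM2l.
have : 0 <= p * p by rewrite mulr_ge0// ltW.
by rewrite /s; lra.
Qed.

Lemma atypical_le n K : (forall a, 6 <= K%:R * pi a) ->
  \sum_(z : {ffun 'I_n -> 'I_k} | ~~ typical K z) \prod_i pi (z i) <=
  \sum_a (1 - pi a / 4) ^+ n.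
Proof.
move=> hK.
apply: le_trans (ler_sum _ (fun a _ => atypical_class n (hK a))).
have pz0 (z : {ffun 'I_n -> 'I_k}) : 0 <= \prod_i pi (z i).
  by apply: prodr_ge0 => i _; exact: ltW.
rewrite (eq_bigr (fun a => \sum_(z : {ffun 'I_n -> 'I_k})
    if (K * n_class z a < n)%N then \prod_i pi (z i) else 0)); last first.
  by move=> a _; rewrite big_mkcond.
rewrite exchange_big/= big_mkcond/=; apply: ler_sum => z _.
case: ifPn => [|_]; last by apply: sumr_ge0 => a _; case: ifP.
rewrite negb_forall => /existsP[a]; rewrite -ltnNge => ha.
rewrite (bigD1 a)//= ha lerDl; apply: sumr_ge0 => b _; by case: ifP.
Qed.

End Atypical.

(** * Error probabilities at fixed size *)

Lemma geometric_half (R : realType) (q : R) M : 0 <= q -> q <= 2^-1 ->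
  \sum_(i < M) q ^+ i.+1 <= 2 * q.
Proof.
move=> q0 q2.
suff : \sum_(i < M) q ^+ i.+1 <= 2 * q - 2 * q ^+ M.+1.
  move=> /le_trans; apply; rewrite gerBl mulr_ge0//; exact: exprn_ge0.
elim: M => [|j IH]; first by rewrite big_ord0 expr1 subrr.
rewrite big_ord_recr/=.
have : q ^+ j.+2 <= 2^-1 * q ^+ j.+1 by rewrite exprS ler_wpM2r// exprn_ge0.
move: IH; set A := \sum_(i < j) _; set B := q ^+ j.+1; set C := q ^+ j.+2.
lra.
Qed.

Section ErrorBounds.
Variables (R : realType) (k0 K : nat) (pi0 : 'I_k0 -> R) (S0 : 'I_k0 -> 'I_k0 -> R).
Variables (eps : R) (n : nat) (rho : R).
Hypotheses (hk0 : (0 < k0)%N) (hK : (0 < K)%N) (hn : (1 < n)%N).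
Hypotheses (pi0_gt0 : forall a, 0 < pi0 a) (pi0_sum : \sum_a pi0 a = 1).
Hypotheses (S_sym : forall a b, S0 a b = S0 b a) (S_ge0 : forall a b, 0 <= S0 a b).
Hypotheses (rho_gt0 : 0 < rho) (rho_le : forall a b, rho * S0 a b <= 1) (eps0 : 0 < eps).

Local Notation Y := {ffun 'I_n * 'I_n -> bool}.

Let T0 (p : 'I_k0 * 'I_k0) : R := rho * S0 p.1 p.2.

Let T0_itv p : 0 <= T0 p <= 1.
Proof. by rewrite /T0 mulr_ge0 ?(ltW rho_gt0)//= rho_le. Qed.

Definition typ_lik (x : network n) : R :=
  \sum_(z : {ffun 'I_n -> 'I_k0} | typical K z) \prod_i pi0 (z i) * edge_lik T0 z x.

Definition atyp_lik (x : network n) : R :=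
  \sum_(z : {ffun 'I_n -> 'I_k0} | ~~ typical K z) \prod_i pi0 (z i) * edge_lik T0 z x.

Let pz_ge0 (z : {ffun 'I_n -> 'I_k0}) : 0 <= \prod_i pi0 (z i).
Proof. by apply: prodr_ge0 => i _; exact: ltW. Qed.

Let pz_le1 (z : {ffun 'I_n -> 'I_k0}) : \prod_i pi0 (z i) <= 1.
Proof.
apply: prod_le1 => i _; rewrite (ltW (pi0_gt0 _))/= -pi0_sum (bigD1 (z i))//= lerDl.
by apply: sumr_ge0 => b _; exact: ltW.
Qed.

Lemma sbm_lik_split x :
  sbm_lik pi0 (fun a b => rho * S0 a b) x = typ_lik x + atyp_lik x.
Proof.
rewrite /sbm_lik (bigID (fun z : {ffun 'I_n -> 'I_k0} => typical K z))/=.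
by congr (_ + _); apply: eq_bigr => z _; apply: sbm_jointE => a b;
  rewrite /T0 /cell; case: ifP => //= _; rewrite S_sym.
Qed.

Lemma typ_lik_ge0 x : 0 <= typ_lik x.
Proof. by apply: sumr_ge0 => z _; rewrite mulr_ge0// edge_lik_ge0. Qed.

Lemma atyp_lik_ge0 x : 0 <= atyp_lik x.
Proof. by apply: sumr_ge0 => z _; rewrite mulr_ge0// edge_lik_ge0. Qed.

Lemma sum_atyp_lik : (forall a, 6 <= K%:R * pi0 a) ->
  \sum_(y in @upper n) atyp_lik (sym_net y) <= \sum_a (1 - pi0 a / 4) ^+ n.
Proof.
move=> h6; apply: le_trans (atypical_le pi0_gt0 pi0_sum n h6).
rewrite /atyp_lik exchange_big/=; apply: ler_sum => z _.
by rewrite -mulr_sumr sum_edge_lik mulr1.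
Qed.

Let rn : R := Num.sqrt n%:R.
Let dim : nat := (k0.-1 + k0 * k0.+1)%N.

Definition ratio_const : R := prior_mass R k0 / lower_const R k0 K.

Lemma ratio_const_gt0 : 0 < ratio_const.
Proof. by rewrite divr_gt0 ?prior_mass_gt0 ?lower_const_gt0. Qed.

Lemma typ_lik_le_KT x : typ_lik x <= ratio_const * rn ^+ dim * KT R k0 x.
Proof.
have lc0 := lower_const_gt0 R hk0 hK.
have pm0 := prior_mass_gt0 R hk0.
rewrite (KTE R hk0) /ratio_const.
have -> : prior_mass R k0 / lower_const R k0 K * rn ^+ dim *
    ((\sum_(z : {ffun 'I_n -> 'I_k0}) prior_int (joint_prior z x)) / prior_mass R k0)
  = (rn ^+ dim * \sum_(z : {ffun 'I_n -> 'I_k0}) prior_int (joint_prior z x)) / lower_const R k0 K.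
  by field; rewrite !gt_eqF.
rewrite ler_pdivlMr// /typ_lik mulr_suml mulr_sumr.
rewrite [leRHS](bigID (fun z : {ffun 'I_n -> 'I_k0} => typical K z))/= -[leLHS]addr0.
apply: lerD; last first.
  apply: sumr_ge0 => z _; rewrite mulr_ge0 ?exprn_ge0 ?sqrtr_ge0//.
  exact/ltW/joint_prior_int_gt0.
apply: ler_sum => z tz; apply: joint_lower => //; first by exact: ltnW.
- exact: (forallP tz).
- by move=> a; exact: ltW.
Qed.

Let x_crit (x : network n) k : Prop := KT_crit eps x k0 <= KT_crit eps x k.

Lemma crit_KT x k : (0 < k)%N -> x_crit x k ->
  KT R k0 x <= KT R k x * expR (pen eps k0 n - pen eps k n).
Proof.
move=> hk; rewrite /x_crit /KT_crit => h.
rewrite -[leLHS]lnK ?posrE ?KT_gt0// -[X in _ <= X * _]lnK ?posrE ?KT_gt0//.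
by rewrite -expRD ler_expR; lra.
Qed.

Let n1 : 1 <= n%:R :> R. Proof. by rewrite ler1n ltnW. Qed.
Let n_gt0 : 0 < n%:R :> R. Proof. by apply: lt_le_trans n1. Qed.
Let ln0 : 0 <= ln n%:R :> R. Proof. exact: ln_ge0. Qed.
Let rn2 : rn * rn = n%:R. Proof. by rewrite -expr2 sqr_sqrtr// ltW. Qed.
Let rn0 : 0 < rn. Proof. by rewrite sqrtr_gt0. Qed.
Let rnE : expR (ln n%:R / 2) = rn.
Proof.
rewrite -[RHS]lnK ?posrE//; congr expR.
have : ln (rn * rn) = ln rn + ln rn by rewrite lnM ?posrE.
by rewrite rn2; lra.
Qed.

(** Here dim + 4 = k0 (k0 + 2) + 3, so q is the penalty factor for the step from k0 to k0 + 1
    without its eps part; later steps are at least as strong. The 4 is the surplus n^-2 over the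
    cost [rn ^+ dim] of the box. *)
Let q : R := (rn ^+ (dim + 4))^-1.

Let q0 : 0 < q. Proof. by rewrite invr_gt0 exprn_gt0. Qed.

Let q_half : q <= 2^-1.
Proof.
rewrite lef_pV2 ?posrE ?exprn_gt0// exprD.
have r1 : 1 <= rn by rewrite /rn -[leLHS]sqrtr1 ler_wsqrtr.
have -> : rn ^+ 4 = n%:R * n%:R by rewrite -rn2; ring.
have n2 : 2 <= n%:R :> R by rewrite ler_nat.
rewrite -[leLHS]mul1r; apply: ler_pM => //; first exact: exprn_ege1.
by rewrite -[leLHS]mulr1; apply: ler_pM.
Qed.

Lemma pen_over m : expR (pen eps k0 n - pen eps (k0 + m)%N n) <= q ^+ m.
Proof.
elim: m => [|m IH]; first by rewrite addn0 subrr expR0 expr0.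
rewrite addnS {2}/pen big_nat_recr/=; last by rewrite (leq_trans hk0)// leq_addr.
rewrite -/(pen eps (k0 + m) n) opprD addrA expRD exprSr.
apply: ler_pM => //; rewrite ?expR_ge0// /q -rnE -expRM_natl -expRN ler_expR lerN2.
rewrite [leLHS](_ : _ = (dim + 4)%:R / 2 * ln n%:R); last by ring.
apply: ler_wpM2r => //.
have h : (dim + 4 <= (k0 + m) * (k0 + m + 2) + 3)%N.
  rewrite /dim; move: hk0; case: (k0) => // k' _ /=; nia.
have : (dim + 4)%:R <= ((k0 + m) * (k0 + m + 2) + 3)%:R :> R by rewrite ler_nat.
by move: eps0; lra.
Qed.

(** The offending order varies with the network and has no a priori bound. There are finitely many
    networks of size n, so one choice per network is bounded by some M, and the geometric decay in q
    makes the estimate independent of M. *)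
Lemma sum_over (B : pred Y) :
  (forall y, B y -> exists2 k, (k0 < k)%N & x_crit (sym_net y) k) ->
  \sum_(y in @upper n | B y) typ_lik (sym_net y) <= 2 * ratio_const / n%:R ^+ 2.
Proof.
move=> hB.
have hm y : exists m, B y -> x_crit (sym_net y) (k0 + m.+1).
  have [By|By] := boolP (B y); last by exists 0%N.
  have [k kk hk] := hB y By; exists (k - k0).-1 => _.
  by rewrite prednK ?subn_gt0// subnKC// ltnW.
have [m {}hm] := choice hm.
pose M := (\max_(y : Y) m y).+1.
have mM y : (m y < M)%N by rewrite ltnS leq_bigmax.
pose c := ratio_const * rn ^+ dim.
have c0 : 0 < c by rewrite mulr_gt0 ?ratio_const_gt0 ?exprn_gt0.
apply: (@le_trans _ _ (\sum_(y in @upper n) c * \sum_(i < M) q ^+ i.+1 * KT R (k0 + i.+1) (sym_net y))).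
  rewrite big_mkcondr/=; apply: ler_sum => y _.
  have KT0 i : 0 <= q ^+ i.+1 * KT R (k0 + i.+1) (sym_net y).
    by rewrite mulr_ge0 ?exprn_ge0 ?(ltW q0)//; apply/ltW/KT_gt0; rewrite addnS.
  case: ifPn => By; last by rewrite mulr_ge0 ?(ltW c0)// sumr_ge0.
  apply: le_trans (typ_lik_le_KT _) _; rewrite ler_pM2l//.
  rewrite (bigD1 (Ordinal (mM y)))//= -[leLHS]addr0; apply: lerD; last by apply: sumr_ge0.
  apply: le_trans (crit_KT _ (hm y By)) _; first by rewrite addnS.
  rewrite mulrC ler_wpM2r ?pen_over//; apply/ltW/KT_gt0; by rewrite addnS.
rewrite -mulr_sumr exchange_big/=.
apply: (@le_trans _ _ (c * \sum_(i < M) q ^+ i.+1)).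
  rewrite ler_pM2l//; apply: ler_sum => i _; rewrite -mulr_sumr ler_piMr ?exprn_ge0 ?(ltW q0)//.
  by apply: sum_KT_upper; rewrite addnS.
have hq := geometric_half M (ltW q0) q_half.
apply: le_trans (_ : c * (2 * q) <= _); first by rewrite ler_pM2l.
rewrite /c /q exprD; have -> : rn ^+ 4 = n%:R ^+ 2 by rewrite -rn2; ring.
rewrite le_eqVlt; apply/orP; left; apply/eqP; field.
by rewrite !gt_eqF// exprn_gt0.
Qed.

Variable gamma : R.
Hypothesis gamma0 : 0 < gamma.
Hypothesis sep : forall a b, a != b ->
  exists c, gamma <= (Num.sqrt (S0 c a) - Num.sqrt (S0 c b)) ^+ 2.
Hypothesis n_large : (2 * (K * k0) <= n)%N.

Definition pen_coef : R := \sum_(1 <= i < k0) (((i * (i + 2) + 3)%:R + eps) / 2).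

(** The summands pay, in this order, for the box, for the penalty, for the true and the fitted
    labellings, and for the grid. In [sep_rate] the last halving comes from the affinity bound, and
    k0 stands for every smaller k. *)
Definition under_rate : R := dim%:R + pen_coef + 2 * k0%:R + 4 * (k0 * k0)%:R.
Definition sep_rate : R := gamma / (8 * (K * k0)%:R ^+ 2) / 2.

Let pen_ge0 k : 0 <= pen eps k n.
Proof.
apply: sumr_ge0 => i _; rewrite mulr_ge0// divr_ge0// addr_ge0 ?ler0n ?(ltW eps0)//.
Qed.

Let n_le_exp : n%:R <= expR n%:R :> R.
Proof. by apply: le_trans (expR_ge1Dx _); rewrite lerDr. Qed.

Let M' : R := ratio_const * rn ^+ dim * expR (pen eps k0 n).

Let M'_ge0 : 0 <= M'.
Proof.
apply: mulr_ge0; last exact: expR_ge0.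
by apply: mulr_ge0; [exact/ltW/ratio_const_gt0|exact/exprn_ge0/ltW].
Qed.

Let M'_bound : Num.sqrt M' <= (1 + ratio_const) * expR ((dim%:R + pen_coef) * n%:R).
Proof.
have rc0 := ratio_const_gt0.
have M0 := M'_ge0.
(* The crude bound sqrt x <= 1 + x costs nothing on the scale exp(O(n)). *)
apply: (@le_trans _ _ (1 + M')).
  have := sqr_ge0 (Num.sqrt M' - 1); have := sqr_sqrtr M0; rewrite !expr2.
  have := sqrtr_ge0 M'; lra.
have pc0 : 0 <= pen_coef.
  by apply: sumr_ge0 => i _; rewrite divr_ge0// addr_ge0 ?ler0n ?(ltW eps0).
have penE : pen eps k0 n = pen_coef * ln n%:R by rewrite /pen /pen_coef mulr_suml.
have h1 : expR (pen eps k0 n) <= expR (pen_coef * n%:R).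
  rewrite ler_expR penE ler_wpM2l//.
  by rewrite -ler_expR lnK ?posrE.
have h2 : rn ^+ dim <= expR (dim%:R * n%:R).
  rewrite expRM_natl; apply: lerXn2r; rewrite ?nnegrE ?expR_ge0 ?(ltW rn0)//.
  apply: le_trans n_le_exp; rewrite -rn2 ler_peMr ?(ltW rn0)//.
  by rewrite /rn -[leLHS]sqrtr1 ler_wsqrtr.
rewrite mulrDl mul1r; apply: lerD.
  by rewrite -[leLHS]expR0 ler_expR mulr_ge0// addr_ge0.
rewrite /M' mulrDl expRD -mulrA ler_pM2l//.
by apply: ler_pM; rewrite ?exprn_ge0 ?expR_ge0 ?(ltW rn0).
Qed.

(** On the error event [typ_lik] is below the sum of its own conditional likelihoods and also below
    M' times the grid sum for k, hence below their geometric mean. Subadditivity of the square root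
    turns this into a sum of affinities, one for each triple of labellings and grid point. *)
Lemma sum_under k (B : pred Y) : (0 < k)%N -> (k < k0)%N ->
  (forall y, B y -> x_crit (sym_net y) k) ->
  \sum_(y in @upper n | B y) typ_lik (sym_net y) <=
  (1 + ratio_const) * expR (under_rate * n%:R - sep_rate * (rho * n%:R ^+ 2)).
Proof.
move=> hk kk0 hB.
have rc0 := ratio_const_gt0.
have M0 := M'_ge0.
pose Z := {ffun 'I_n -> 'I_k0}. pose Z' := {ffun 'I_n -> 'I_k}.
pose lk (z : Z) y := edge_lik T0 z (@sym_net n y).
pose lk' (z' : Z') (g : grid n k) y := edge_lik (grid_par R g) z' (@sym_net n y).
have lk0 z y : 0 <= lk z y by exact: edge_lik_ge0.
have lk'0 z g y : 0 <= lk' z g y by apply: edge_lik_ge0 => p; exact: grid_par_itv.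
apply: (@le_trans _ _ (\sum_(y in @upper n) Num.sqrt M' *
   \sum_(z : Z | typical K z) \sum_(z' : Z') \sum_(g : grid n k) Num.sqrt (lk z y * lk' z' g y))).
  rewrite big_mkcondr/=; apply: ler_sum => y _.
  have s0 : 0 <= \sum_(z : Z | typical K z) \sum_(z' : Z') \sum_(g : grid n k) Num.sqrt (lk z y * lk' z' g y).
    by do 3!apply: sumr_ge0 => ? _; exact: sqrtr_ge0.
  case: ifPn => By; last by rewrite mulr_ge0// sqrtr_ge0.
  have h1 : typ_lik (sym_net y) <= \sum_(z : Z | typical K z) lk z y.
    by apply: ler_sum => z _; apply: ler_piMl; [exact: lk0|exact: pz_le1].
  have h2 : typ_lik (sym_net y) <= M' * \sum_(z' : Z') \sum_(g : grid n k) lk' z' g y.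
    apply: le_trans (typ_lik_le_KT _) _; rewrite /M' -[leRHS]mulrA.
    rewrite ler_pM2l; last by rewrite mulr_gt0// exprn_gt0.
    apply: le_trans (crit_KT hk (hB y By)) _; rewrite mulrC.
    apply: ler_pM; rewrite ?expR_ge0//; first exact/ltW/KT_gt0.
      by rewrite ler_expR gerBl.
    exact: KT_le_grid.
  have t0 := typ_lik_ge0 (sym_net y).
  rewrite -[leLHS]ger0_norm// -sqrtr_sqr.
  apply: (@le_trans _ _ (Num.sqrt (M' * \sum_(z : Z | typical K z) \sum_(z' : Z') \sum_(g : grid n k) (lk z y * lk' z' g y)))).
    rewrite ler_wsqrtr//; apply: le_trans (_ : (\sum_(z : Z | typical K z) lk z y) *
        (M' * \sum_(z' : Z') \sum_(g : grid n k) lk' z' g y) <= _).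
      by rewrite expr2; apply: ler_pM.
    rewrite mulrCA ler_wpM2l// mulr_suml; apply: ler_sum => z _.
    rewrite mulr_sumr; apply: ler_sum => z' _; by rewrite mulr_sumr.
  rewrite sqrtrM// ler_wpM2l ?sqrtr_ge0//.
  apply: le_trans (sqrtr_sum_le _ _ _) _ => [z|].
    by apply: sumr_ge0 => ? _; apply: sumr_ge0 => ? _; rewrite mulr_ge0.
  apply: ler_sum => z _; apply: le_trans (sqrtr_sum_le _ _ _) _ => [z'|].
    by apply: sumr_ge0 => ? _; rewrite mulr_ge0.
  by apply: ler_sum => z' _; apply: sqrtr_sum_le => g; rewrite mulr_ge0.
rewrite -mulr_sumr.
pose ex := expR (- (sep_rate * (rho * n%:R ^+ 2))).
have hsum : \sum_(y in @upper n) \sum_(z : Z | typical K z) \sum_(z' : Z') \sum_(g : grid n k)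
    Num.sqrt (lk z y * lk' z' g y) <= \sum_(z : Z) \sum_(z' : Z') \sum_(g : grid n k) ex.
  rewrite exchange_big/= big_mkcond/=; apply: ler_sum => z _.
  case: ifPn => tz; last by do 2!apply: sumr_ge0 => ? _; exact: expR_ge0.
  rewrite exchange_big/=; apply: ler_sum => z' _.
  rewrite exchange_big/=; apply: ler_sum => g _.
  apply: le_trans (sum_sqrt_lik z z' T0_itv (grid_par_itv R g)) _.
  rewrite ler_expR mulNr lerN2.
  have := @separation R n k0 k K hk hK z z' S0 rho gamma (grid_par R g) S_sym rho_gt0 gamma0 sep tz kk0.
  rewrite (leq_trans _ n_large) ?leq_mul2l ?(ltnW kk0) ?orbT// => /(_ isT) h.
  rewrite -(@ler_pM2r _ 2)// mulfVK//; apply: le_trans h.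
  rewrite /sep_rate mulrAC mulfVK// ler_wpM2r ?mulr_ge0 ?exprn_ge0 ?(ltW rho_gt0) ?(ltW n_gt0)//.
  rewrite ler_pM2l// lef_pV2 ?posrE ?mulr_gt0 ?exprn_gt0 ?ltr0n ?muln_gt0 ?hK//.
  rewrite ler_pM2l// lerXn2r ?nnegrE// ler_nat leq_mul2l (ltnW kk0) orbT//.
apply: (@le_trans _ _ (((1 + ratio_const) * expR ((dim%:R + pen_coef) * n%:R)) *
   (\sum_(z : Z) \sum_(z' : Z') \sum_(g : grid n k) ex))).
  apply: ler_pM; [exact: sqrtr_ge0| |exact: M'_bound|exact: hsum].
  by do 4!apply: sumr_ge0 => ? _; exact: sqrtr_ge0.
have sc (F : finType) (c : R) : \sum_(x : F) c = #|{: F}|%:R * c.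
  by rewrite sumr_const mulr_natl.
rewrite !sc card_grid !card_ffun !card_ord.
rewrite -mulrA ler_pM2l; last by rewrite addr_gt0.
have knat (j : nat) : (j <= k0)%N -> (j ^ n)%:R <= expR (k0%:R * n%:R) :> R.
  move=> jk; rewrite natrX mulrC expRM_natl; apply: lerXn2r; rewrite ?nnegrE ?expR_ge0//.
  apply: (@le_trans _ _ k0%:R); first by rewrite ler_nat.
  by apply: le_trans (expR_ge1Dx _); rewrite lerDr.
have hg : ((((n * n).+1 * (n * n).+1) ^ (k * k))%N)%:R <= expR (4 * (k0 * k0)%:R * n%:R) :> R.
  apply: (@le_trans _ _ (expR (4 * n%:R) ^+ (k * k))).
    rewrite natrX; apply: lerXn2r; rewrite ?nnegrE ?expR_ge0//.
    rewrite (_ : 4 * n%:R = n%:R + n%:R + (n%:R + n%:R)); last by ring.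
    rewrite expRD natrM.
    have h : (n * n).+1%:R <= expR (n%:R + n%:R) :> R.
      rewrite expRD; apply: (@le_trans _ _ ((1 + n%:R) * (1 + n%:R))).
        by rewrite -natr1 natrM; have := n_gt0; lra.
      by apply: ler_pM; rewrite ?addr_ge0 ?expR_ge1Dx// ltW.
    by apply: ler_pM.
  rewrite -expRM_natl ler_expR [leRHS](_ : _ = (k0 * k0)%:R * (4 * n%:R)); last by ring.
  rewrite ler_wpM2r ?mulr_ge0 ?(ltW n_gt0)// ler_nat.
  by apply: leq_mul; exact: ltnW.
apply: le_trans (_ : expR ((dim%:R + pen_coef) * n%:R) * (expR (k0%:R * n%:R) *
    (expR (k0%:R * n%:R) * (expR (4 * (k0 * k0)%:R * n%:R) * ex))) <= _).
  apply: ler_wpM2l; first exact: expR_ge0.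
  have ex0 : 0 <= ex by exact: expR_ge0.
  apply: ler_pM; rewrite ?knat// ?mulr_ge0//.
  apply: ler_pM; rewrite ?knat ?(ltnW kk0)// ?mulr_ge0//.
  exact: ler_wpM2r.
rewrite /ex -!expRD ler_expR /under_rate.
by rewrite le_eqVlt; apply/orP; left; apply/eqP; ring.
Qed.

Lemma sum_error (B : pred Y) : (forall a, 6 <= K%:R * pi0 a) ->
  (forall y, B y -> exists k, [/\ (0 < k)%N, k <> k0 &
     KT_crit eps (sym_net y) k0 <= KT_crit eps (sym_net y) k]) ->
  \sum_(y in @upper n | B y) sbm_lik pi0 (fun a b => rho * S0 a b) (sym_net y) <=
  \sum_a (1 - pi0 a / 4) ^+ n + 2 * ratio_const / n%:R ^+ 2 +
  k0%:R * ((1 + ratio_const) * expR (under_rate * n%:R - sep_rate * (rho * n%:R ^+ 2))).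
Proof.
move=> h6 hB.
pose Bo (y : Y) := `[< exists2 k, (k0 < k)%N & x_crit (sym_net y) k >].
(* The index type contains 0, which is not an admissible order; for it the event is empty. *)
pose Bu (k : 'I_k0) (y : Y) := (0 < k)%N && `[< x_crit (sym_net y) k >].
rewrite (eq_bigr _ (fun y _ => sbm_lik_split _)) big_split/= addrC -addrA.
apply: lerD.
  apply: le_trans (sum_atyp_lik h6); rewrite big_mkcondr/=.
  by apply: ler_sum => y _; case: ifP => // _; exact: atyp_lik_ge0.
apply: (@le_trans _ _ (\sum_(y in @upper n | Bo y) typ_lik (sym_net y) +
    \sum_(k < k0) \sum_(y in @upper n | Bu k y) typ_lik (sym_net y))).
  rewrite !big_mkcondr/=.
  rewrite [X in _ <= _ + X](eq_bigr (fun k => \sum_(y in @upper n)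
     (if Bu k y then typ_lik (sym_net y) else 0))); last by move=> k _; rewrite big_mkcondr.
  rewrite [X in _ <= _ + X]exchange_big/= -big_split/=; apply: ler_sum => y _.
  have t0 := typ_lik_ge0 (sym_net y).
  have s0 (P : pred 'I_k0) : 0 <= \sum_(k < k0 | P k) (if Bu k y then typ_lik (sym_net y) else 0).
    by apply: sumr_ge0 => k _; case: ifP.
  case: ifPn => By; last by rewrite addr_ge0//; case: ifP.
  have [k [hk kk0 hc]] := hB y By.
  have [lk|lk|//] := ltngtP k k0; last first.
    rewrite (_ : Bo y); first by rewrite lerDl.
    by apply/asboolP; exists k.
  rewrite (bigD1 (Ordinal lk))//= (_ : Bu _ y); last by rewrite /Bu/= hk; apply/asboolP.
  rewrite addrCA lerDl addr_ge0//; by case: ifP.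
apply: lerD; first by apply: sum_over => y /asboolP.
apply: (@le_trans _ _ (\sum_(k < k0) ((1 + ratio_const) *
    expR (under_rate * n%:R - sep_rate * (rho * n%:R ^+ 2))))); last first.
  by rewrite sumr_const card_ord mulr_natl.
apply: ler_sum => k _; have [hk|hk] := posnP k.
  rewrite big_pred0 => [|y]; last by rewrite /Bu hk/= andbF.
  by rewrite mulr_ge0 ?expR_ge0// addr_ge0//; exact/ltW/ratio_const_gt0.
by apply: (sum_under hk (ltn_ord k)) => y /andP[_ /asboolP].
Qed.

End ErrorBounds.

(** * Almost sure convergence *)

Section Law.
Variables (R : realType) (d : measure_display) (Omega : measurableType d).
Variable Prob : probability Omega R.

Lemma measure_bigsetU_le (I : Type) (s : seq I) (P : pred I) (A : I -> set Omega) :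
  (forall i, measurable (A i)) ->
  (Prob (\big[setU/set0]_(i <- s | P i) A i) <= \sum_(i <- s | P i) Prob (A i))%E.
Proof.
move=> mA; elim: s => [|i s IH]; first by rewrite !big_nil measure0.
rewrite !big_cons; case: ifP => // _.
apply: le_trans (measureU2 _ _ _) _ => //; last exact: leeD2l.
exact: bigsetU_measurable.
Qed.

Variables (n : nat) (X : Omega -> network n) (f : network n -> R).
Hypothesis law : forall x : network n, measurable [set w | X w = x] /\
  Prob [set w | X w = x] = (if valid_network x then f x else 0)%:E.
Hypothesis f0 : forall x, 0 <= f x.

Local Notation Y := {ffun 'I_n * 'I_n -> bool}.

Definition full_net (y : Y) : network n := fun i j => y (i, j).

Lemma network_event (B : network n -> Prop) :
  [set w | B (X w)] =
  \big[setU/set0]_(y : Y | `[< B (full_net y) >]) [set w | X w = full_net y].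
Proof.
rewrite -bigcup_seq_cond; apply/seteqP; split.
- move=> w /= Bw; pose y : Y := [ffun e => X w e.1 e.2].
  have e : X w = full_net y by apply/funext => i; apply/funext => j; rewrite /full_net ffunE.
  by exists y => //=; rewrite mem_index_enum; apply/asboolP; rewrite -e.
- by move=> w [y /= /andP[_ /asboolP By] ->].
Qed.

Lemma network_event_measurable (B : network n -> Prop) : measurable [set w | B (X w)].
Proof.
by rewrite network_event; apply: bigsetU_measurable => y _; have [] := law (full_net y).
Qed.

Lemma network_event_le (B : network n -> Prop) :
  (Prob [set w | B (X w)] <=
   (\sum_(y in @upper n | `[< B (sym_net y) >]) f (sym_net y))%:E)%E.
Proof.
rewrite network_event; apply: le_trans (measure_bigsetU_le _ _ _) _.
  by move=> y; have [] := law (full_net y).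
rewrite (eq_bigr (fun y => (if valid_network (full_net y) then f (full_net y) else 0)%:E)); last first.
  by move=> y _; have [] := law (full_net y).
rewrite sumEFin lee_fin -big_mkcondr/=.
(* Valid arrays are reindexed by their upper triangles: [h] symmetrizes and [h'] truncates. *)
pose h (y : Y) : Y := [ffun e => sym_net y e.1 e.2].
pose h' (y : Y) : Y := [ffun e : 'I_n * 'I_n => ((e.1 < e.2)%N && y e)].
have fh y : full_net (h y) = sym_net y.
  by apply/funext => i; apply/funext => j; rewrite /full_net ffunE.
rewrite (reindex_onto h h'); last first.
  move=> y /andP[_ /andP[/forallP irr /forallP sym]].
  apply/ffunP => -[i j]; rewrite !ffunE/= /sym_net !ffunE/=.
  have sy a b : y (a, b) = y (b, a) by exact/eqP/(forallP (sym a)).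
  case: (ltngtP i j) => [ij|ij|ij] /=; [by []|by rewrite sy|].
  have -> : i = j by exact: val_inj.
  by have := irr j; rewrite /full_net => /negbTE ->.
rewrite big_mkcond [leRHS]big_mkcond; apply: ler_sum => y _.
rewrite fh; case: ifPn => [/andP[/andP[By _] /eqP hy]|_]; last by case: ifP.
rewrite By andbT (_ : y \in @upper n)//.
apply/pfamilyP; split; last by move=> e _; rewrite inE.
apply/fintype.subsetP => e; rewrite !inE -hy ffunE; by case: (_ < _)%N.
Qed.

End Law.

Section BorelCantelli.
Variables (R : realType) (d : measure_display) (Omega : measurableType d).
Variable Prob : probability Omega R.

(** Summability is phrased through a nonnegative potential u: the partial sums telescope and stay
    below u N, so no series has to be evaluated before Borel-Cantelli applies. *)
Lemma ae_eventually_not (E : nat -> set Omega) (u : nat -> R) (N : nat) :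
  (forall n, measurable (E n)) -> (forall n, 0 <= u n) ->
  (forall n, (N <= n)%N -> (Prob (E n) <= (u n - u n.+1)%:E)%E) ->
  {ae Prob, forall w, \forall n \near \oo, ~ E n w}.
Proof.
move=> mE u0 hu.
pose F n := E (N + n)%N.
have hs : (\sum_(n <oo) Prob (F n) < +oo)%E.
  apply: (@le_lt_trans _ _ (u N)%:E); last exact: ltry.
  have hn n : (\sum_(0 <= i < n) Prob (F i) <= (u N - u (N + n)%N)%:E)%E.
    elim: n => [|n IH]; first by rewrite big_nil addn0 subrr.
    rewrite big_nat_recr//=; apply: le_trans (leeD IH (hu (N + n)%N _)) _.
      exact: leq_addr.
    by rewrite -EFinD lee_fin addnS; lra.
  have cv : cvgn (fun n => \sum_(0 <= i < n) Prob (F i))%E.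
    by apply: is_cvg_nneseries => i _ _; exact: measure_ge0.
  apply: (lime_le cv); apply: nearW => n; apply: le_trans (hn n) _.
  by rewrite lee_fin gerBl.
have := lim_sup_set_cvg0 (fun n => mE (N + n)%N : measurable (F n)) hs.
have mF : measurable (lim_sup_set F).
  apply: bigcap_measurable => // i _; apply: bigcup_measurable => j _; exact: mE.
move=> /(negligibleP Prob mF); apply: negligibleS => w /= hw i _.
apply: contrapT => hi; apply: hw; exists (N + i)%N => // n /= hin Enw; apply: hi.
exists (n - N)%N => /=; first by rewrite leq_subRL// (leq_trans _ hin)// leq_addr.
by rewrite /F subnKC// (leq_trans _ hin)// leq_addr.
Qed.

End BorelCantelli.

Unset Implicit Arguments.

Theorem theorem1 (R : realType) (d : measure_display) (Omega : measurableType d)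
  (Prob : probability Omega R)
  (k0 : nat) (pi0 : 'I_k0 -> R) (S0 : 'I_k0 -> 'I_k0 -> R) (rho : nat -> R)
  (X : forall n : nat, Omega -> network n) (eps : R) :
  (* (pi0, S0): parameters of an SBM of order k0 *)
  (0 < k0)%N ->
  (forall a, 0 < pi0 a) -> \sum_(a < k0) pi0 a = 1 ->
  (forall a b, S0 a b = S0 b a) -> (forall a b, 0 <= S0 a b) ->
  (forall a b, a != b -> exists c, S0 c a != S0 c b) ->
  (* P0_n = rho_n S0 : dense regime (rho = 1) or sparse regime *)
  (forall n, 0 < rho n /\ forall a b, rho n * S0 a b <= 1) ->
  ((forall n, rho n = 1) \/
   (rho @ \oo --> (0 : R) /\ (fun n : nat => n%:R * rho n) @ \oo --> +oo)) ->
  (* law of the observed network on n nodes *)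
  (forall n (x : network n), measurable [set w | X n w = x] /\
     Prob [set w | X n w = x] =
       (if valid_network x
        then sbm_lik pi0 (fun a b => rho n * S0 a b) x else 0)%:E) ->
  0 < eps ->
  {ae Prob, forall w, \forall n \near \oo,
     forall k : nat, (0 < k)%N -> k <> k0 ->
       KT_crit eps (X n w) k < KT_crit eps (X n w) k0}.
Proof.
move=> hk0 pi0_gt0 pi0_sum S_sym S_ge0 S_sep hrho regime law eps0.
(* The threshold 6 is the one used in the Chernoff bound for small classes. *)
have [K hK h6] : exists2 K : nat, (0 < K)%N & forall a, 6 <= K%:R * pi0 a.
  exists (\sum_a Num.bound (6 / pi0 a)).+1 => // a.
  have h : 6 / pi0 a < (Num.bound (6 / pi0 a))%:R.
    by apply: archi_boundP; rewrite divr_ge0// ltW.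
  rewrite -ler_pdivrMr//; apply: le_trans (ltW h) _; rewrite ler_nat.
  by rewrite (bigD1 a)//= -addnS leq_addr.
have [gamma gamma0 sep] : exists2 gamma, 0 < gamma & forall a b, a != b ->
    exists c, gamma <= (Num.sqrt (S0 c a) - Num.sqrt (S0 c b)) ^+ 2.
  have hc (p : 'I_k0 * 'I_k0) : exists c, p.1 != p.2 -> S0 c p.1 != S0 c p.2.
    have [->|ne] := eqVneq p.1 p.2; first by exists (Ordinal hk0).
    by have [c hc] := S_sep _ _ ne; exists c.
  have [c {}hc] := choice hc.
  have [p pp|g g0 hg] := @finite_pos_lower_bound R ('I_k0 * 'I_k0)%type
    (fun p => p.1 != p.2)
    (fun p => (Num.sqrt (S0 (c p) p.1) - Num.sqrt (S0 (c p) p.2)) ^+ 2).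
    rewrite exprn_even_gt0//= subr_eq0; apply: contra (hc p pp) => /eqP e.
    by rewrite -(sqr_sqrtr (S_ge0 (c p) p.1)) e sqr_sqrtr.
  by exists g => // a b ab; exists (c (a, b)); exact: (hg (a, b)).
(* From here on the two regimes enter only through this divergence. *)
have nrho : (fun n : nat => n%:R * rho n) @ \oo --> +oo.
  case: regime => [rho1|[]//].
  rewrite (_ : (fun n => _) = (fun n : nat => n%:R)); first exact: cvgr_idn.
  by apply/funext => n; rewrite rho1 mulr1.
pose A := under_rate k0 eps; pose c := sep_rate k0 K gamma.
have c0 : 0 < c.
  by rewrite /c /sep_rate !divr_gt0// mulr_gt0// exprn_gt0// ltr0n muln_gt0 hK.
(* Beyond this index A - c n rho is at most -1, so the underestimation exponent is at most -n. *)
have [N1 _ hN1] := (cvgryPge _).1 nrho ((A + 1) / c).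
pose N := maxn N1 (maxn 2 (2 * (K * k0))).
pose E n := [set w | exists k, [/\ (0 < k)%N, k <> k0 &
   KT_crit eps (X n w) k0 <= KT_crit eps (X n w) k]].
pose rc := ratio_const R k0 K.
have rc0 : 0 < rc by exact: ratio_const_gt0.
pose r a := 1 - pi0 a / 4.
have r01 a : 0 < r a < 1.
  have pa : pi0 a <= 1.
    by rewrite -pi0_sum (bigD1 a)//= lerDl; apply: sumr_ge0 => b _; exact: ltW.
  by have := pi0_gt0 a; rewrite /r; lra.
pose e1 : R := expR (- 1).
have e01 : 0 < e1 < 1 by rewrite expR_gt0/= expR_lt1; lra.
pose C : R := k0%:R * (1 + rc).
have C0 : 0 <= C by rewrite mulr_ge0// addr_ge0// ltW.
(* Decrements of the three parts dominate the three error terms: the geometric parts telescope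
   exactly, and 4 rc (1 / n - 1 / (n + 1)) is at least 2 rc / n^2 for n >= 1. *)
pose u n : R := \sum_a r a ^+ n / (1 - r a) + 4 * rc / n%:R + C * (e1 ^+ n / (1 - e1)).
have mE n : measurable (E n).
  exact: (@network_event_measurable _ _ _ _ _ _ _ (law n) (fun x => exists k,
    [/\ (0 < k)%N, k <> k0 & KT_crit eps x k0 <= KT_crit eps x k])).
have u0 n : 0 <= u n.
  rewrite /u !addr_ge0//.
  - apply: sumr_ge0 => a _; have /andP[h1 h2] := r01 a.
    by apply: divr_ge0; [exact/exprn_ge0/ltW|rewrite subr_ge0 ltW].
  - by rewrite divr_ge0// mulr_ge0// ltW.
  - have /andP[h1 h2] := e01.
    apply: mulr_ge0 => //.
    by apply: divr_ge0; [exact/exprn_ge0/ltW|rewrite subr_ge0 ltW].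
have geo (x : R) n : x < 1 -> x ^+ n / (1 - x) - x ^+ n.+1 / (1 - x) = x ^+ n.
  by move=> x1; rewrite exprS; field; rewrite gt_eqF// subr_gt0.
have hu n : (N <= n)%N -> (Prob (E n) <= (u n - u n.+1)%:E)%E.
  rewrite !geq_max => /and3P[nN1 n2 nK].
  have [rho0 rho1] := hrho n.
  have f0 (x : network n) : 0 <= sbm_lik pi0 (fun a b => rho n * S0 a b) x.
    apply: sumr_ge0 => z _.
    have /andP[//] : 0 <= sbm_joint pi0 (fun a b => rho n * S0 a b) z x <= 1.
    apply: joint_itv => //.
    - by move=> a; exact: ltW.
    - by move=> a b; rewrite S_sym.
    - by move=> a b; rewrite rho1 andbT mulr_ge0// ltW.
  apply: le_trans (network_event_le (law n) f0 (fun x => exists k,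
    [/\ (0 < k)%N, k <> k0 & KT_crit eps x k0 <= KT_crit eps x k])) _.
  rewrite lee_fin.
  apply: le_trans (sum_error hk0 hK n2 pi0_gt0 pi0_sum S_sym S_ge0 rho0 rho1 eps0
    gamma0 sep nK h6 _) _; first by move=> y /asboolP.
  have n0 : 0 < n%:R :> R by rewrite ltr0n ltnW.
  have n1 : 1 <= n%:R :> R by rewrite ler1n ltnW.
  have -> : u n - u n.+1 = \sum_a (r a ^+ n / (1 - r a) - r a ^+ n.+1 / (1 - r a))
     + (4 * rc / n%:R - 4 * rc / n.+1%:R)
     + C * (e1 ^+ n / (1 - e1) - e1 ^+ n.+1 / (1 - e1)).
    by rewrite sumrB /u; ring.
  apply: lerD; first apply: lerD.
  - apply: ler_sum => a _; have /andP[h1 h2] := r01 a.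
    by rewrite geo.
  - rewrite -/rc -[n.+1%:R]natr1 ler_pdivrMr ?exprn_gt0//.
    have -> : (4 * rc / n%:R - 4 * rc / (n%:R + 1)) * n%:R ^+ 2 =
      2 * rc * (2 * n%:R / (n%:R + 1)).
      by field; rewrite !gt_eqF// addr_gt0.
    apply: ler_peMr; first by rewrite mulr_ge0// ltW.
    rewrite ler_pdivlMr ?addr_gt0// mul1r; lra.
  - rewrite mulrA -/rc -/C ler_wpM2l//; have /andP[h1 h2] := e01.
    rewrite geo//.
    rewrite /e1 -expRM_natl ler_expR -/A -/c.
    have := hN1 n nN1; rewrite /= ler_pdivrMr// => h.
    have -> : A * n%:R - c * (rho n * n%:R ^+ 2) = n%:R * (A - n%:R * rho n * c) by ring.
    by rewrite ler_pM2l//; lra.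
have := ae_eventually_not mE u0 hu; apply: filterS => w; apply: filterS => n hE k hk kk0.
by rewrite ltNge; apply/negP => h; apply: hE; exists k.
Qed.
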